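(* Let $m,n,r,s$ be positive integers, and let $k',k$ be integers with $2\le k'\le\min\{m,n\}$ and $1\le k\le\min\{r,s\}$. The following conditions are equivalent for a (complex) linear map $\Phi:M_{m,n}(\mathbb{C})\to M_{r,s}(\mathbb{C})$. (a) $F_k(\Phi(A))=F_{k'}(A)$ for all $A\in M_{m,n}(\mathbb{C})$ with rank at most $2$. (b) There are unitary matrices $U\in M_{r,r}(\mathbb{C})$, $V\in M_{s,s}(\mathbb{C})$ and positive-definite diagonal matrices $Q_1,Q_2$ (maybe vacuous) of sizes $q_1,q_2$ such that $k\ge 2(q_1+q_2)$, $Q_1\oplus Q_2$ has trace $1$, and $$\Phi(A)=U\begin{pmatrix} A\otimes Q_1 & 0 & 0\\ 0 & A^t\otimes Q_2 & 0\\ 0&0&0\end{pmatrix}V\qquad\text{for all } A\in M_{m,n}(\mathbb{C}).$$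
   Context: $M_{m,n}(\mathbb{C})$ is the space of $m\times n$ complex matrices; $A^t$ is the transpose. For a matrix $A$ of size $m\times n$ with singular values $s_1(A)\ge\cdots\ge s_h(A)$, $h=\min\{m,n\}$, and $1\le k\le h$, the Ky Fan $k$-norm is $F_k(A)=\sum_{j=1}^k s_j(A)$. $\otimes$ is the Kronecker product. ''Vacuous'' means of size $0$, in which case the corresponding block is absent; zero blocks have whatever (possibly zero) sizes make the block matrix $r\times s$. *)

(* Defs.v *)
From HB Require Import structures.
From mathcomp Require Import all_boot all_order all_algebra.
From mathcomp Require Import sesquilinear spectral.
From mathcomp Require Import reals.
From mathcomp Require Import complex mxtens.

Set Implicit Arguments.
Unset Strict Implicit.
Unset Printing Implicit Defensive.

Import Order.TTheory GRing.Theory Num.Theory.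
Local Open Scope ring_scope.
Local Open Scope complex_scope.

Definition ctmx (R : realType) (m n : nat) (A : 'M[R[i]]_(m, n)) :
    'M[R[i]]_(n, m) := map_mx Num.conj A^T.

(* [spectral_diag] lists the eigenvalues of the Hermitian matrix [A^* A], with
   multiplicity but in no particular order; they are nonnegative reals, so
   [complex.Re] loses nothing.  At least [n - minn m n] of them are zero, and
   [take] drops that many zeros. *)
Definition singular_values (R : realType) (m n : nat)
    (A : 'M[R[i]]_(m, n)) : seq R :=
  take (minn m n)
    (sort >=%R
       [seq Num.sqrt (complex.Re (spectral_diag (ctmx A *m A) 0 j))
          | j <- enum 'I_n]).

(* Meaningful for [1 <= k <= minn m n]. *)
Definition ky_fan (R : realType) (m n k : nat) (A : 'M[R[i]]_(m, n)) : R :=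
  \sum_(j < k) (singular_values A)`_j.

(* The order on [R[i]] is partial: [0 < z] says that [z] is real and positive. *)
Definition posdefmx (R : realType) (n : nat) (Q : 'M[R[i]]_n) : Prop :=
  Q \is hermsymmx /\
  forall x : 'cV[R[i]]_n, x != 0 -> 0 < (ctmx x *m Q *m x) 0 0.

(* Main.v *)
Require Import Defs.
From HB Require Import structures.
From mathcomp Require Import all_boot all_order all_algebra.
From mathcomp Require Import perm mxpoly.
From mathcomp Require Import sesquilinear spectral.
From mathcomp Require Import reals.
From mathcomp Require Import complex mxtens.
From mathcomp Require Import ring.

Set Implicit Arguments.
Unset Strict Implicit.
Unset Printing Implicit Defensive.

Import Order.TTheory GRing.Theory Num.Theory.
Local Open Scope ring_scope.
Local Open Scope complex_scope.

(** A matrix A of rank at most 2 has at most two nonzero singular values, so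
for k' >= 2 the norm F_k'(A) is their sum, the trace norm of A.  All that is
used of the Ky Fan norms is Ky Fan's maximum principle: F_k(X) is the largest
value of Re tr (P X Q^H) over matrices P and Q with k orthonormal rows
([top_trace], [ky_fan_variational]).

(b) implies (a).  If A = U^H S V is a singular value decomposition of length
at most 2, then tensoring with Q1 and Q2 produces a singular value
decomposition of Phi(A) of length at most 2 (q1 + q2) <= k.  Hence F_k(Phi(A))
counts all singular values of Phi(A), and their sum is
tr S * tr (Q1 (+) Q2) = tr S ([sufficiency]).

(a) implies (b), orthogonality.  Let x1, x2 and y1, y2 be orthonormal pairs
of rows, X = Phi(x1^H y1) and Y = Phi(x2^H y2).  For every unimodular mu the
hypothesis gives F_k(X + mu Y) = F_k(X) + F_k(Y).  A pair (P, Q) that is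
optimal for X + mu Y is then optimal for X and for mu Y.  Optimality makes
A = Q^H P X and B = mu Q^H P Y positive semidefinite, and conj(mu) A B is the
restriction of X^H Y to the row space of Q.  If A B were nonzero it would have
an eigenvalue c > 0, and conj(mu) c would be an eigenvalue of the fixed matrix
X^H Y; as this matrix has finitely many eigenvalues, A B = 0 for some mu.
Then X and Y have no component outside the row spaces of P and Q, because
exchanging one direction of (P, Q) would otherwise increase the trace.  It
follows that X^H Y = 0, X Y^H = 0 and rank (X + mu Y) <= k
([orth_of_phases]).

(a) implies (b), structure.  Thus Phi maps orthogonal matrices of rank one to
orthogonal matrices.  Testing this on the unit vectors and on sums and
differences of two of them gives quadratic relations between the matrices
T i j = Phi(E_ij) ([disjoint_family]).  In the expected form
T i j = E_ij (x) Q1 (+) E_ji (x) Q2 the matrix T00^H T01 T01^H T00 is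
E_00 (x) Q1^4, extended by zero; in general, its eigenvectors with nonzero
eigenvalue generate orthonormal frames U i, V j with T i j V j = U i D
([frame_exists]).  The same construction for the transposed family gives the
second summand.  Nothing else remains, since (T i j^H T i j)^2 is the sum of
the two matrices that are diagonalized ([frame_decomposition]).  Finally
2 (q1 + q2) is the rank of Phi(E_00 + mu E_11) for a unimodular mu as above,
and the trace condition is F_k(Phi(E_00)) = 1 ([necessity]). *)

(** * Adjoints and positive semidefinite matrices *)

(** The arguments hold over any [numClosedFieldType]; on complex numbers over a
[realType] this is convertible to [ctmx]. *)
Definition adjmx (C : numClosedFieldType) m n (A : 'M[C]_(m, n)) :
  'M[C]_(n, m) := map_mx Num.conj A^T.

Local Notation "A ^H" := (adjmx A) (at level 8, format "A ^H").

Section Adjoint.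
Variable C : numClosedFieldType.

Lemma adjmxE m n (A : 'M[C]_(m, n)) i j : A^H i j = (A j i)^*%R.
Proof. by rewrite !mxE. Qed.

Lemma addmxE m n (A B : 'M[C]_(m, n)) i j : (A + B) i j = A i j + B i j.
Proof. by rewrite mxE. Qed.

Lemma oppmxE m n (A : 'M[C]_(m, n)) i j : (- A) i j = - A i j.
Proof. by rewrite mxE. Qed.

Lemma scalemxE m n a (A : 'M[C]_(m, n)) i j : (a *: A) i j = a * A i j.
Proof. by rewrite mxE. Qed.

Lemma adjmxK m n (A : 'M[C]_(m, n)) : A^H^H = A.
Proof. by apply/matrixP=> i j; rewrite !adjmxE conjCK. Qed.

Lemma adjmxM m n p (A : 'M[C]_(m, n)) (B : 'M[C]_(n, p)) :
  (A *m B)^H = B^H *m A^H.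
Proof. by rewrite /adjmx trmx_mul map_mxM. Qed.

Lemma adjmxD m n (A B : 'M[C]_(m, n)) : (A + B)^H = A^H + B^H.
Proof. by rewrite /adjmx linearD /= map_mxD. Qed.

Lemma adjmxN m n (A : 'M[C]_(m, n)) : (- A)^H = - A^H.
Proof. by rewrite /adjmx linearN /= map_mxN. Qed.

Lemma adjmxB m n (A B : 'M[C]_(m, n)) : (A - B)^H = A^H - B^H.
Proof. by rewrite adjmxD adjmxN. Qed.

Lemma adjmxZ m n a (A : 'M[C]_(m, n)) : (a *: A)^H = a^*%R *: A^H.
Proof. by rewrite /adjmx linearZ /= map_mxZ. Qed.

Lemma adjmx0 m n : (0 : 'M[C]_(m, n))^H = 0.
Proof. by rewrite /adjmx trmx0 map_mx0. Qed.

Lemma adjmx1 n : (1%:M : 'M[C]_n)^H = 1%:M.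
Proof. by rewrite /adjmx trmx1 map_mx1. Qed.

Lemma mulmx_adjC0 m n p (A : 'M[C]_(m, n)) (B : 'M[C]_(p, n)) :
  A *m B^H = 0 -> B *m A^H = 0.
Proof. by move=> AB0; rewrite -[B]adjmxK -adjmxM AB0 adjmx0. Qed.

Lemma unitaryP m n {U : 'M[C]_(m, n)} :
  reflect (U *m U^H = 1%:M) (U \is unitarymx).
Proof. exact: unitarymxP. Qed.

Lemma unitary_adjK n (U : 'M[C]_n) : U \is unitarymx -> U^H *m U = 1%:M.
Proof. by move/unitaryP/mulmx1C. Qed.

Lemma gram_diag_ge0 m n (A : 'M[C]_(m, n)) i : 0 <= (A *m A^H) i i.
Proof. by rewrite mxE sumr_ge0 // => j _; rewrite adjmxE mul_conjC_ge0. Qed.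

Lemma mulmx_adj_eq0 m n (A : 'M[C]_(m, n)) : A *m A^H = 0 -> A = 0.
Proof.
move=> A0; apply/matrixP=> i j; move/matrixP/(_ i i): A0; rewrite !mxE.
move/eqP; rewrite psumr_eq0 => [/allP/(_ j)|k _].
  by rewrite mem_index_enum adjmxE mul_conjC_eq0 => /(_ isT)/eqP.
by rewrite adjmxE mul_conjC_ge0.
Qed.

Lemma adj_mulmx_eq0 m n (A : 'M[C]_(m, n)) : A^H *m A = 0 -> A = 0.
Proof.
by rewrite -{2}[A]adjmxK => /mulmx_adj_eq0 A0; rewrite -[A]adjmxK A0 adjmx0.
Qed.

(** The difference of the two sides is the squared length of the component of
row i of A orthogonal to the rows of U. *)
Lemma bessel m n (U : 'M[C]_(m, n)) p (A : 'M[C]_(p, n)) i :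
  U \is unitarymx -> (A *m U^H *m (A *m U^H)^H) i i <= (A *m A^H) i i.
Proof.
move=> /unitaryP UU; rewrite -subr_ge0.
suff <- : ((A - A *m U^H *m U) *m (A - A *m U^H *m U)^H) i i =
          (A *m A^H) i i - (A *m U^H *m (A *m U^H)^H) i i by exact: gram_diag_ge0.
rewrite adjmxB !adjmxM adjmxK mulmxBl !mulmxBr.
rewrite (mulmxA (A *m U^H *m U) U^H) -(mulmxA (A *m U^H)) UU mulmx1.
by rewrite !mulmxA subrr subr0 !mxE.
Qed.

Definition psd n (N : 'M[C]_n) := forall x : 'rV_n, 0 <= (x *m N *m x^H) 0 0.

Lemma psd_gram m n (A : 'M[C]_(m, n)) : psd (A^H *m A).
Proof.
move=> x; rewrite !mulmxA -mulmxA.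
by rewrite -[A in A *m x^H]adjmxK -adjmxM gram_diag_ge0.
Qed.

Lemma qform_delta m n (N : 'M[C]_(m, n)) i j :
  ((delta_mx 0 i : 'rV_m) *m N *m (delta_mx 0 j : 'rV_n)^H) 0 0 = N i j.
Proof.
have -> : (delta_mx 0 j : 'rV[C]_n)^H = delta_mx j 0.
  by apply/matrixP=> a b; rewrite adjmxE !mxE conjC_nat andbC.
by rewrite -rowE -colE !mxE.
Qed.

(** Polarization: the cross terms of x and y are separated by the two scalars
1 and 'i, so this is special to complex scalars. *)
Lemma qform_eq0 n (M : 'M[C]_n) :
  (forall x : 'rV_n, (x *m M *m x^H) 0 0 = 0) -> M = 0.
Proof.
move=> M0; apply/matrixP=> i j; rewrite [RHS]mxE -qform_delta.
set x : 'rV_n := delta_mx 0 i; set y : 'rV_n := delta_mx 0 j.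
have E (z : C) : z^*%R * (x *m M *m y^H) 0 0 + z * (y *m M *m x^H) 0 0 = 0.
  have := M0 (x + z *: y).
  rewrite adjmxD adjmxZ !(mulmxDl, mulmxDr) -!scalemxAl -!scalemxAr.
  by rewrite !(addmxE, scalemxE) !M0 !mulr0 add0r addr0 addrC.
have := E 1; have := E 'i%R; rewrite conjC1 conjCi !mul1r mulNr addrC => /eqP.
rewrite subr_eq0 => /eqP/(mulfI (neq0Ci C)) -> /eqP.
by rewrite -mulr2n mulrn_eq0 /= => /eqP.
Qed.

(** The quadratic form of N^H - N vanishes because that of N is real. *)
Lemma psd_herm n (N : 'M[C]_n) : psd N -> N^H = N.
Proof.
move=> Np; apply/eqP; rewrite -subr_eq0; apply/eqP/qform_eq0 => x.
rewrite mulmxBr mulmxBl addmxE oppmxE; apply/eqP; rewrite subr_eq0.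
have -> : x *m N^H *m x^H = (x *m N *m x^H)^H by rewrite !adjmxM adjmxK mulmxA.
by rewrite adjmxE; apply/eqP/conj_Creal/ger0_real/Np.
Qed.

Lemma psd_diag n (N : 'M[C]_n) i : psd N -> 0 <= N i i.
Proof. by move=> Np; rewrite -qform_delta. Qed.

Lemma psd_conj m n (N : 'M[C]_n) (A : 'M[C]_(m, n)) :
  psd N -> psd (A *m N *m A^H).
Proof. by move=> Np x; rewrite !mulmxA -mulmxA -adjmxM. Qed.

Lemma psd_spectral n (N : 'M[C]_n) : psd N ->
  (forall j, 0 <= spectral_diag N 0 j) /\
  N = (spectralmx N)^H *m diag_mx (spectral_diag N) *m spectralmx N.
Proof.
move=> Np.
have Nn : N \is normalmx.
  by apply/normalmxP; change (N *m N^H = N^H *m N); rewrite psd_herm.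
have SU := spectral_unitarymx N.
have E : N = (spectralmx N)^H *m diag_mx (spectral_diag N) *m spectralmx N.
  by rewrite {1}(orthomx_spectralP Nn) invmx_unitary.
split=> // j.
have -> : spectral_diag N 0 j = (spectralmx N *m N *m (spectralmx N)^H) j j.
  rewrite {3}E !mulmxA (unitaryP SU) mul1mx -mulmxA (unitaryP SU) mulmx1.
  by rewrite mxE eqxx.
exact/psd_diag/psd_conj.
Qed.

Lemma sqrt_diagK n (d : 'rV[C]_n) :
  diag_mx (map_mx sqrtC d) *m diag_mx (map_mx sqrtC d) = diag_mx d.
Proof.
rewrite mulmx_diag; congr diag_mx; apply/rowP=> a.
by rewrite !mxE -expr2 sqrtCK.
Qed.

Lemma adj_diag_ge0 n (e : 'rV[C]_n) : (forall j, 0 <= e 0 j) ->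
  (diag_mx e)^H = diag_mx e.
Proof.
move=> e0; apply/matrixP=> i j; rewrite adjmxE !mxE.
case: eqVneq => [->|_]; last by rewrite !mulr0n conjC0.
by rewrite !mulr1n conj_Creal // ger0_real.
Qed.

Lemma psd_gramP n (N : 'M[C]_n) : psd N -> exists A : 'M[C]_n, N = A^H *m A.
Proof.
move=> /psd_spectral[]; set d := spectral_diag N; set S := spectralmx N.
move=> d0 ->; exists (diag_mx (map_mx sqrtC d) *m S).
rewrite adjmxM adj_diag_ge0 => [|j]; last by rewrite mxE sqrtC_ge0.
by rewrite !mulmxA -(mulmxA S^H _ (diag_mx _)) sqrt_diagK.
Qed.

End Adjoint.

(** * Matrices with orthonormal rows *)

Section OrthonormalRows.
Variable C : numClosedFieldType.

Lemma adj_col_mx p q n (U : 'M[C]_(p, n)) (W : 'M[C]_(q, n)) :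
  (col_mx U W)^H = row_mx U^H W^H.
Proof. by rewrite /adjmx tr_col_mx map_row_mx. Qed.

Lemma unitary_rowsub p q n (U : 'M[C]_(q, n)) (f : 'I_p -> 'I_q) :
  injective f -> U \is unitarymx -> rowsub f U \is unitarymx.
Proof.
move=> fI /unitaryP UU; apply/unitaryP/matrixP=> i j.
have := congr1 (fun M : 'M_q => M (f i) (f j)) UU.
rewrite !mxE (inj_eq fI) => <-.
by apply: eq_bigr => l _; rewrite !adjmxE !mxE.
Qed.

Lemma unitary_col_mx p q n (U : 'M[C]_(p, n)) (W : 'M[C]_(q, n)) :
  U \is unitarymx -> W \is unitarymx -> U *m W^H = 0 ->
  col_mx U W \is unitarymx.
Proof.
move=> /unitaryP UU /unitaryP WW UW; apply/unitaryP.
have WU := mulmx_adjC0 UW.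
rewrite adj_col_mx mul_col_row.
by rewrite UU WW UW WU -scalar_mx_block.
Qed.

(** The extra rows come from an orthonormal basis of the kernel of U^H, whose
dimension is n - p. *)
Lemma unitary_complete p q n (U : 'M[C]_(p, n)) : U \is unitarymx ->
  (p + q <= n)%N ->
  exists2 W : 'M[C]_(q, n), W \is unitarymx & U *m W^H = 0.
Proof.
move=> Uu pqn; set K := kermx U^H.
have rK : \rank K = (n - p)%N.
  by rewrite mxrank_ker /adjmx mxrank_map mxrank_tr mxrank_unitary.
have qK : (q <= \rank K)%N by rewrite rK leq_subRL // (leq_trans _ pqn) ?leq_addr.
set S := schmidt (row_base K).
have Su : S \is unitarymx by apply: schmidt_unitarymx; rewrite rank_leq_col.
have SU : S *m U^H = 0.
  apply/sub_kermxP; rewrite -/K eqmx_schmidt_free ?row_base_free //.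
  by rewrite eq_row_base.
exists (rowsub (widen_ord qK) S).
  by apply: unitary_rowsub => // i j /(congr1 val)/= /val_inj.
apply: mulmx_adjC0; rewrite mul_rowsub_mx SU.
by apply/matrixP=> i j; rewrite !mxE.
Qed.

(** P consists of the first k rows of U if k < p, and of U completed by k - p
further rows otherwise.  Such a P picks the first k terms out of a singular
value decomposition with left factor U. *)
Lemma unitary_align p k n (U : 'M[C]_(p, n)) : U \is unitarymx -> (k <= n)%N ->
  exists2 P : 'M[C]_(k, n), P \is unitarymx &
    forall i j, (P *m U^H) i j = (i == j :> nat)%:R.
Proof.
move=> Uu kn; have [pk|kp] := leqP p k.
  move: kn; rewrite -(subnKC pk); set q := (k - p)%N => kn.
  have [W Wu UW] := unitary_complete Uu kn.
  exists (col_mx U W); first exact: unitary_col_mx.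
  move=> i j; rewrite mul_col_mx (unitaryP Uu) (mulmx_adjC0 UW).
  case: (split_ordP i) => a ->; rewrite ?(col_mxEu, col_mxEd) mxE //=.
  by rewrite gtn_eqF // (leq_trans (ltn_ord j)) ?leq_addr.
exists (rowsub (widen_ord (ltnW kp)) U).
  by apply: unitary_rowsub => // i j /(congr1 val)/= /val_inj.
by move=> i j; rewrite mul_rowsub_mx (unitaryP Uu) !mxE.
Qed.

End OrthonormalRows.

(** * Singular value decomposition *)

Section SingularValues.
Variable R : realType.

(** The relabelling f makes the sorted list usable as a reindexing of the
eigenvalues; beyond its end the list is extended by the default value 0, which
keeps it nonincreasing. *)
Lemma sort_ge_nth n (t : 'I_n -> R) (L := sort >=%R [seq t j | j <- enum 'I_n]) :
  (forall j, 0 <= t j) ->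
  [/\ size L = n, exists f : 'I_n -> 'I_n,
         injective f /\ forall i : 'I_n, L`_i = t (f i),
      forall i, 0 <= L`_i & forall i j, (i <= j)%N -> L`_j <= L`_i].
Proof.
move=> t0.
have sL : size L = n by rewrite size_sort size_map size_enum_ord.
have L0 i : 0 <= L`_i.
  have [iL|iL] := ltnP i (size L); last by rewrite nth_default.
  by have /mem_nth -/(_ 0) := iL; rewrite mem_sort => /mapP[j _ ->].
split=> //.
  have sz : size (enum 'I_n) == n by rewrite size_enum_ord.
  have sLn : size L == n by rewrite sL.
  have : perm_eq (Tuple sLn) (map_tuple t (Tuple sz)).
    by rewrite /= perm_sort.
  case/tuple_permP=> p Lp; exists p; split; first exact: perm_inj.
  move=> i; rewrite -[L]/(tval (Tuple sLn)) Lp /= (nth_map i) ?size_enum_ord //.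
  by rewrite !(tnth_nth (t i)) /= nth_ord_enum (nth_map i) ?size_enum_ord // nth_ord_enum.
move=> i j ij; have [jL|jL] := ltnP j (size L); last by rewrite (nth_default _ jL).
have Ls : sorted >=%R L by apply: sort_sorted => x y; exact: le_total.
apply: (sorted_leq_nth _ _ _ Ls) => //.
- by move=> x y z /= yx zx; exact: le_trans zx yx.
- by move=> x /=.
- exact: leq_ltn_trans jL.
Qed.

(** The rows of V are eigenvectors of X^H X in the order of the sorted singular
values, and those of U are the rescaled images under X.  The sequence s is
extended by zeros beyond p, so that sums over i < k make sense for all k. *)
Lemma svd m n (X : 'M[R[i]]_(m, n)) :
  exists (p : nat) (U : 'M[R[i]]_(p, m)) (V : 'M[R[i]]_(p, n)) (s : nat -> R),
  [/\ U \is unitarymx /\ V \is unitarymx,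
      X = U^H *m diag_mx (\row_(i < p) (s i)%:C) *m V,
      forall i, 0 <= s i /\ ((p <= i)%N -> s i = 0),
      forall i j, (i <= j)%N -> s j <= s i &
      forall k, (k <= minn m n)%N -> ky_fan k X = \sum_(i < k) s i].
Proof.
set N := X^H *m X.
have := psd_spectral (psd_gram X); rewrite -/N => -[d0 NE].
have Su := spectral_unitarymx N.
set d := spectral_diag N in d0 NE *; set S := spectralmx N in NE Su *.
pose t j := Num.sqrt (complex.Re (d 0 j)).
have t0 j : 0 <= t j by exact: sqrtr_ge0.
have tt j : d 0 j = (t j * t j)%:C.
  have dr : d 0 j \is Num.real by exact: ger0_real.
  rewrite -expr2 sqr_sqrtr ?RRe_real //.
  by rewrite -ler0c RRe_real.
have [sL [f [fI fL]] L0 Ls] := sort_ge_nth t0.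
set L := sort _ _ in sL fL L0 Ls; pose s i := L`_i.
(* In the sorted list the nonzero singular values come first, so the position
   of the first zero is the rank. *)
pose p := find (fun x => ~~ (0 < x)) L.
have pn : (p <= n)%N by rewrite -sL find_size.
have s_gt0 i : (0 < s i) = (i < p)%N.
  have [ip|pi] := ltnP i p.
    by have := before_find 0 ip => /negbFE.
  apply/negbTE; rewrite -leNgt (le_trans (Ls _ _ pi)) //.
  have [hL|hL] := boolP (has (fun x => ~~ (0 < x)) L).
    by have := nth_find 0 hL; rewrite -leNgt.
  by rewrite nth_default // /p hasNfind.
pose S' := rowsub f S.
have S'u : S' \is unitarymx by exact: unitary_rowsub.
(* The columns of Z are pairwise orthogonal, the i-th one of length s i. *)
pose Z := X *m S'^H.
have ZE i j : (Z^H *m Z) i j = (s i * s i)%:C *+ (i == j).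
  rewrite adjmxM adjmxK !mulmxA -(mulmxA S') -/N NE.
  have -> : S'^H = S^H *m (rowsub f 1%:M)^H.
    by rewrite -adjmxM mul_rowsub_mx mul1mx.
  rewrite !mulmxA mul_rowsub_mx (unitaryP Su) -!mulmxA (mulmxA S) (unitaryP Su).
  rewrite mul1mx mulmxA mul_rowsub_mx mul1mx /s fL -tt.
  rewrite mxE (bigD1 (f j)) //= big1 ?addr0 => [|l lj].
    by rewrite adjmxE !mxE eqxx conjC1 mulr1 (inj_eq fI).
  by rewrite adjmxE !mxE [f j == l]eq_sym (negPf lj) conjC0 mulr0.
have s0 i : (p <= i)%N -> s i = 0.
  by move=> pi; apply/eqP; rewrite eq_le L0 andbT leNgt s_gt0 -leqNgt.
have Z0 i (j : 'I_n) : (p <= j)%N -> Z i j = 0.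
  move=> pj; have /eqP := ZE j j; rewrite eqxx mulr1n.
  rewrite s0 // mulr0 mxE psumr_eq0 => [/allP/(_ i)|l _].
    by rewrite mem_index_enum adjmxE mulrC mul_conjC_eq0 => /(_ isT)/eqP.
  by rewrite adjmxE mulrC mul_conjC_ge0.
have XZ : X = Z *m S' by rewrite -mulmxA unitary_adjK ?mulmx1.
pose w := widen_ord pn; pose V := rowsub w S'.
have wI : injective w by move=> i j /(congr1 val)/= /val_inj.
pose D := diag_mx (\row_(i < p) (s i)%:C).
pose E := diag_mx (\row_(i < p) (s i)^-1%:C).
have DE : D *m E = 1%:M.
  rewrite mulmx_diag; apply/matrixP=> i j; rewrite !mxE -rmorphM /=.
  by rewrite divff // gt_eqF // s_gt0.
have EH : E^H = E.
  apply/matrixP=> i j; rewrite adjmxE !mxE; case: eqVneq => [->|_].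
    by rewrite !mulr1n; exact: conjc_real.
  by rewrite !mulr0n conjC0.
pose U := E *m (colsub w Z)^H.
exists p, U, V, s; split=> //.
- split; last exact: unitary_rowsub.
  apply/unitaryP; rewrite adjmxM adjmxK EH -mulmxA (mulmxA _ _ E).
  have -> : (colsub w Z)^H *m colsub w Z = D *m D.
    apply/matrixP=> i j; rewrite mulmx_diag.
    have := ZE (w i) (w j); rewrite (inj_eq wI) mxE => ZEij.
    rewrite [RHS]mxE !mxE -rmorphM /= -ZEij.
    by apply: eq_bigr => l _; rewrite !adjmxE !mxE.
  by rewrite -mulmxA DE mulmx1; apply: mulmx1C.
- rewrite adjmxM adjmxK EH -(mulmxA _ E) (mulmx1C DE) mulmx1 {1}XZ.
  apply/matrixP=> i j; rewrite !mxE.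
  rewrite (bigID (fun a : 'I_n => (a < p)%N)) /= [X in _ + X]big1 ?addr0.
    by rewrite (big_ord_narrow pn); apply: eq_bigr => a _; rewrite !mxE.
  by move=> a; rewrite -leqNgt => /Z0 ->; rewrite mul0r.
- by move=> i; split; [exact: L0 | exact: s0].
- by move=> k km; apply: eq_bigr => i _; rewrite nth_take // (leq_trans _ km).
Qed.

End SingularValues.

(** * Ky Fan's maximum principle *)

Section Overlap.
Variable C : numClosedFieldType.

(** The difference of the two sides is half of the squared modulus of
conj x - y. *)
Lemma Re_mul_le (x y : C) : 'Re (x * y) <= (x * x^*%R + y * y^*%R) / 2.
Proof.
rewrite ler_pdivlMr ?ltr0n // -[x in 'Re (x * y)]conjCK.
set a := x^*%R; rewrite -subr_ge0.
suff -> : x * a + y * y^*%R - 'Re (a^*%R * y) * 2 = (a - y) * (a - y)^*%R.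
  exact: mul_conjC_ge0.
rewrite ReE divfK ?pnatr_eq0 // rmorphB rmorphM /= !conjCK; ring.
Qed.

(** c j is the mean of the squared lengths of the projections of the j-th row of
U to the row space of P and of the j-th row of V to that of Q.  Bessel's
inequality bounds it by 1; exchanging the roles of (U, V) and (P, Q), Bessel's
inequality for the k rows of P and Q bounds the sum by k. *)
Lemma overlap k p r s (P : 'M[C]_(k, r)) (U : 'M[C]_(p, r))
    (Q : 'M[C]_(k, s)) (V : 'M[C]_(p, s)) :
  P \is unitarymx -> U \is unitarymx -> Q \is unitarymx -> V \is unitarymx ->
  exists c : 'I_p -> C,
    [/\ forall j, 'Re ((V *m Q^H *m P *m U^H) j j) <= c j,
        forall j, 0 <= c j <= 1 & \sum_j c j <= k%:R].
Proof.
move=> Pu Uu Qu Vu; set M := V *m Q^H; set N := U *m P^H.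
have row1 a b n (W : 'M[C]_(a, n)) (T : 'M[C]_(b, n)) i :
    W \is unitarymx -> T \is unitarymx -> (W *m T^H *m (W *m T^H)^H) i i <= 1.
  move=> Wu Tu; apply: le_trans (bessel _ _ Tu) _.
  by rewrite (unitaryP Wu) mxE eqxx.
have trk n (W : 'M[C]_(p, n)) (T : 'M[C]_(k, n)) :
    W \is unitarymx -> T \is unitarymx -> \tr (W *m T^H *m (W *m T^H)^H) <= k%:R.
  move=> Wu Tu; rewrite mxtrace_mulC.
  have -> : W *m T^H = (T *m W^H)^H by rewrite adjmxM adjmxK.
  rewrite adjmxK.
  rewrite -[leRHS](mxtrace1 C k); apply: ler_sum => i _.
  by rewrite [leRHS]mxE eqxx; exact: row1.
exists (fun j => ((M *m M^H) j j + (N *m N^H) j j) / 2); split=> [j|j|].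
- have -> : M *m P *m U^H = M *m N^H by rewrite adjmxM adjmxK mulmxA.
  rewrite !mxE -big_split mulr_suml raddf_sum; apply: ler_sum => l _.
  rewrite !adjmxE; apply: le_trans (Re_mul_le _ _) _.
  by rewrite conjCK [(N j l)^*%R * _]mulrC.
- rewrite divr_ge0 ?addr_ge0 ?gram_diag_ge0 ?ler0n //=.
  by rewrite ler_pdivrMr ?ltr0n // mul1r -[2]/(1 + 1) lerD ?row1.
- rewrite -mulr_suml big_split /= ler_pdivrMr ?ltr0n //.
  by rewrite mulr_natr mulr2n lerD ?trk.
Qed.

Lemma trace_diagE k p r s (P : 'M[C]_(k, r)) (U : 'M[C]_(p, r))
    (Q : 'M[C]_(k, s)) (V : 'M[C]_(p, s)) (d : 'rV[C]_p) :
  \tr (P *m (U^H *m diag_mx d *m V) *m Q^H) =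
  \sum_j d 0 j * (V *m Q^H *m P *m U^H) j j.
Proof.
rewrite -!mulmxA mxtrace_mulC -!mulmxA mxtrace_mulC -!mulmxA.
by apply: eq_bigr => j _; rewrite mul_diag_mx mxE !mulmxA.
Qed.

Lemma trace_aligned k p r s (P : 'M[C]_(k, r)) (U : 'M[C]_(p, r))
    (Q : 'M[C]_(k, s)) (V : 'M[C]_(p, s)) (d : 'rV[C]_p) :
  (forall i j, (P *m U^H) i j = (i == j :> nat)%:R) ->
  (forall i j, (Q *m V^H) i j = (i == j :> nat)%:R) ->
  \tr (P *m (U^H *m diag_mx d *m V) *m Q^H) = \sum_(j < p | (j < k)%N) d 0 j.
Proof.
move=> PU QV; rewrite trace_diagE [RHS]big_mkcond; apply: eq_bigr => j _.
rewrite -!mulmxA mulmxA mxE; have VQ : V *m Q^H = (Q *m V^H)^H.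
  by rewrite adjmxM adjmxK.
have E i : (V *m Q^H) j i * (P *m U^H) i j = (i == j :> nat)%:R.
  by rewrite VQ adjmxE QV PU conjC_nat -natrM mulnb andbb.
under eq_bigr do rewrite E.
case: ltnP => [jk|kj].
  rewrite (bigD1 (Ordinal jk)) //= eqxx big1 ?addr0 ?mulr1 // => i.
  by rewrite -val_eqE /= => /negPf->.
rewrite big1 ?mulr0 // => i _.
by rewrite ltn_eqF // (leq_trans (ltn_ord i)).
Qed.

(** F takes values in C rather than in the reals so that statements and proofs
stay inside one field. *)
Definition top_trace k r s (F : 'M[C]_(r, s) -> C) :=
  (forall X (P : 'M[C]_(k, r)) (Q : 'M[C]_(k, s)),
     P \is unitarymx -> Q \is unitarymx -> 'Re (\tr (P *m X *m Q^H)) <= F X) /\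
  (forall X, exists (P : 'M[C]_(k, r)) (Q : 'M[C]_(k, s)),
     [/\ P \is unitarymx, Q \is unitarymx & \tr (P *m X *m Q^H) = F X]).

(** The order of C is partial: 'Re z <= z already says that z is real. *)
Lemma top_trace_real k r s F (X : 'M[C]_(r, s)) :
  @top_trace k r s F -> F X \is Num.real.
Proof.
case=> Fge Fat; have [P [Q [Pu Qu E]]] := Fat X.
have := Fge X P Q Pu Qu; rewrite E -subr_ge0 => /ger0_real FXR.
by rewrite -(subrK ('Re (F X)) (F X)) rpredD ?Creal_Re.
Qed.

(** P^H D Q is a singular value decomposition with p <= k terms, so the maximum
counts all of them and F is the trace norm here. *)
Lemma top_trace_sum k p r s F (P : 'M[C]_(p, r)) (Q : 'M[C]_(p, s))
    (D : 'M[C]_p) : @top_trace k r s F -> (p <= k <= minn r s)%N ->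
  P \is unitarymx -> Q \is unitarymx ->
  is_diag_mx D -> (forall i, 0 <= D i i) -> F (P^H *m D *m Q) = \tr D.
Proof.
move=> tF /andP[pk krs] Pu Qu /diag_mxP[d ->] d0; have [Fge Fat] := tF.
have dR j : d 0 j \is Num.real by have := d0 j; rewrite mxE eqxx => /ger0_real.
have trd : \tr (diag_mx d) = \sum_(j < p) d 0 j.
  by apply: eq_bigr => j _; rewrite mxE eqxx.
apply/eqP; rewrite eq_le; apply/andP; split.
  have [P1 [Q1 [P1u Q1u E]]] := Fat (P^H *m diag_mx d *m Q).
  rewrite -[leLHS](Creal_ReP _ (top_trace_real _ tF)) -E.
  rewrite trace_diagE raddf_sum /= trd; apply: ler_sum => j _.
  have [c [Gc c01 _]] := overlap P1u Pu Q1u Qu.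
  rewrite ReMl // ler_piMr //; first by have := d0 j; rewrite mxE eqxx.
  by apply: le_trans (Gc j) _; case/andP: (c01 j).
move: (krs); rewrite leq_min => /andP[kr ks].
have [P1 P1u PU] := unitary_align Pu kr; have [Q1 Q1u QV] := unitary_align Qu ks.
have := Fge (P^H *m diag_mx d *m Q) _ _ P1u Q1u.
rewrite (trace_aligned _ PU QV) trd.
rewrite (eq_bigl xpredT); last by move=> j; rewrite (leq_trans _ pk).
by rewrite (Creal_ReP _ _) // rpred_sum.
Qed.

End Overlap.

Section KyFan.
Variable R : realType.
Implicit Types k m n p r : nat.

(** With weights at most 1 and of total at most k, the best choice is to put
weight 1 on the k largest terms.  Subtracting s k from all terms allows a
termwise comparison: s j - s k is nonnegative for j < k and nonpositive
otherwise. *)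
Lemma le_top_sum p k (s : nat -> R) (c : 'I_p -> R) :
  (forall i, 0 <= s i) -> (forall i j, (i <= j)%N -> s j <= s i) ->
  (forall i, (p <= i)%N -> s i = 0) ->
  (forall j, 0 <= c j <= 1) -> \sum_j c j <= k%:R ->
  \sum_(j < p) s j * c j <= \sum_(i < k) s i.
Proof.
move=> s0 sn sp c01 ck.
have top : \sum_(j < p) (s j - s k) * c j <= \sum_(i < k) (s i - s k).
  apply: (@le_trans _ _ (\sum_(j < p | (j < k)%N) (s j - s k))).
    rewrite [leRHS]big_mkcond; apply: ler_sum => j _.
    have /andP[c0 c1] := c01 j; case: ltnP => [jk|kj].
      by rewrite ler_piMr // subr_ge0 sn // ltnW.
    by rewrite mulr_le0_ge0 // subr_le0 sn.
  have [pk|/ltnW kp] := leqP p k.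
    rewrite (sp k pk); under eq_bigr do rewrite subr0.
    under [leRHS]eq_bigr do rewrite subr0.
    rewrite (big_ord_widen_cond k (fun j => (j < k)%N) (fun j => s j)) //.
    rewrite [leRHS](bigID (fun j : 'I_k => (j < p)%N)) /=.
    rewrite (eq_bigl (fun j : 'I_k => (j < p)%N)); last by move=> j; rewrite ltn_ord.
    by rewrite lerDl sumr_ge0.
  by rewrite (big_ord_widen p (fun j => s j - s k) kp).
have : \sum_(j < p) s j * c j <= \sum_(i < k) s i + s k * (\sum_(j < p) c j - k%:R).
  rewrite mulrBr mulr_sumr addrCA -lerBlDl -sumrB.
  move: top; under eq_bigr do rewrite mulrBl.
  by rewrite [X in _ <= X -> _]sumrB sumr_const card_ord mulr_natr.
move/le_trans; apply; rewrite gerDl mulr_ge0_le0 // subr_le0 //.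
Qed.

Lemma ky_fan_ge k m n (X : 'M[R[i]]_(m, n)) (P : 'M[R[i]]_(k, m))
    (Q : 'M[R[i]]_(k, n)) : (k <= minn m n)%N ->
  P \is unitarymx -> Q \is unitarymx ->
  'Re (\tr (P *m X *m Q^H)) <= (ky_fan k X)%:C.
Proof.
move=> kmn Pu Qu.
have [p [U [V [s [[Uu Vu] XE s0 sn ->]]]]] := svd X; last by [].
have [c [Gc c01 ck]] := overlap Pu Uu Qu Vu.
have cR j : c j = (complex.Re (c j))%:C.
  by rewrite RRe_real // ger0_real //; case/andP: (c01 j).
rewrite XE trace_diagE raddf_sum /=.
apply: (@le_trans _ _ (\sum_(j < p) (s j * complex.Re (c j))%:C)).
  apply: ler_sum => j _; rewrite mxE ReMl ?rmorphM /=; last first.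
    by apply/complex_realP; exists (s j).
  by rewrite -cR ler_wpM2l // ler0c; case: (s0 j).
rewrite -rmorph_sum lecR; apply: le_top_sum => //.
- by move=> i; case: (s0 i).
- by move=> i; case: (s0 i).
- by move=> j; rewrite -!lecR -cR; exact: c01.
- by rewrite -lecR rmorph_sum rmorph_nat; under eq_bigr do rewrite /= -cR.
Qed.

Lemma ky_fan_attained k m n (X : 'M[R[i]]_(m, n)) : (k <= minn m n)%N ->
  exists (P : 'M[R[i]]_(k, m)) (Q : 'M[R[i]]_(k, n)),
    [/\ P \is unitarymx, Q \is unitarymx &
        \tr (P *m X *m Q^H) = (ky_fan k X)%:C].
Proof.
move=> kmn; have [p [U [V [s [[Uu Vu] XE s0 sn ->]]]]] := svd X; last by [].
move: (kmn); rewrite leq_min => /andP[km kn].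
have [P Pu PU] := unitary_align Uu km; have [Q Qu QV] := unitary_align Vu kn.
exists P, Q; split=> //; rewrite XE trace_aligned //.
under eq_bigr do rewrite mxE.
rewrite -rmorph_sum; congr (_%:C).
have sp i : (p <= i)%N -> s i = 0 by case: (s0 i).
have [pk|/ltnW kp] := leqP p k; last by rewrite (big_ord_widen p s kp).
rewrite (big_ord_widen_cond k (fun j => (j < k)%N) s) //.
rewrite [RHS](bigID (fun j : 'I_k => (j < p)%N)) /= [X in _ + X]big1.
  by rewrite addr0; apply: eq_bigl => j; rewrite ltn_ord.
by move=> j; rewrite -leqNgt => /sp.
Qed.

Lemma ky_fan_variational k m n : (k <= minn m n)%N ->
  top_trace k (fun X : 'M[R[i]]_(m, n) => (ky_fan k X)%:C).
Proof.
move=> kmn; split=> [X P Q Pu Qu|X]; first exact: ky_fan_ge.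
exact: ky_fan_attained.
Qed.

End KyFan.

(** * Optimal pairs and orthogonality *)

Section Maximizers.
Variable C : numClosedFieldType.

Lemma trace_row n (x y : 'rV[C]_n) : \tr (x^H *m y) = (y *m x^H) 0 0.
Proof. by rewrite mxtrace_mulC [LHS]big_ord1. Qed.

Lemma norm_row_gt0 n (x : 'rV[C]_n) : x != 0 -> 0 < (x *m x^H) 0 0.
Proof.
move=> x0; rewrite lt_def gram_diag_ge0 andbT; apply: contraNneq x0 => xx.
by apply/eqP/mulmx_adj_eq0; rewrite [LHS]mx11_scalar xx raddf0.
Qed.

Lemma unit_row n (x : 'rV[C]_n) : x != 0 ->
  exists2 t, 0 < t & (t *: x) \is unitarymx.
Proof.
move=> x0; have n0 := norm_row_gt0 x0; set N := (x *m x^H) 0 0 in n0.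
exists (sqrtC N)^-1; first by rewrite invr_gt0 sqrtC_gt0.
apply/unitaryP; rewrite adjmxZ -scalemxAl -scalemxAr scalerA.
rewrite [x *m x^H]mx11_scalar -/N scale_scalar_mx; congr (_%:M).
rewrite conj_Creal ?rpredV ?ger0_real ?sqrtC_ge0 ?ltW //.
by rewrite -invfM -expr2 sqrtCK mulVf // gt_eqF.
Qed.

(** Let c = x N x^H.  Testing with the unitary matrix that multiplies x by a
unimodular w and fixes its orthogonal complement gives Re (w c) <= Re c.  For
w = conj c / |c| this reads |c| <= Re c, whence 0 <= c. *)
Lemma psd_of_trace_max n (N : 'M[C]_n) :
  (forall W : 'M[C]_n, W \is unitarymx -> 'Re (\tr (W *m N)) <= 'Re (\tr N)) ->
  psd N.
Proof.
move=> Nmax x; set c := (x *m N *m x^H) 0 0.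
have [x00|x0] := eqVneq x 0; first by rewrite /c x00 !mul0mx mxE.
have n0 := norm_row_gt0 x0; set t := (x *m x^H) 0 0 in n0.
have main w : `|w| = 1 -> 'Re (w * c) <= 'Re c.
  move=> w1; pose g := (w - 1) / t; pose W := 1%:M + g *: (x^H *m x).
  have ww : w * w^*%R = 1 by rewrite -normCK w1 expr1n.
  have tR : t^*%R = t by rewrite conj_Creal // gtr0_real.
  have Wu : W \is unitarymx.
    apply/unitaryP; rewrite /W adjmxD adjmx1 adjmxZ adjmxM adjmxK.
    rewrite mulmxDl mul1mx mulmxDr mulmx1 -scalemxAl -scalemxAr.
    rewrite mulmxA -(mulmxA x^H) [x *m x^H]mx11_scalar -/t mul_mx_scalar.
    rewrite -scalemxAl !scalerA -!addrA -!scalerDl.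
    suff -> : g^*%R + (g + g * (g^*%R * t)) = 0 by rewrite scale0r addr0.
    rewrite /g rmorphM /= fmorphV rmorphB /= conjC1 tR.
    have t1 : t != 0 by rewrite gt_eqF.
    transitivity ((w * w^*%R - 1) / t); first by field.
    by rewrite ww subrr mul0r.
  have := Nmax _ Wu; rewrite /W mulmxDl mul1mx raddfD /= -scalemxAl linearZ /=.
  rewrite -mulmxA trace_row -/c raddfD /= gerDl /g => H.
  rewrite -subr_le0 -raddfB /= -{2}[c]mul1r -mulrBl.
  have : t * 'Re ((w - 1) / t * c) <= 0 by rewrite pmulr_rle0.
  rewrite -ReMl ?gtr0_real // mulrA mulrCA divff ?gt_eqF // mulr1.
  by [].
have [->//|c0] := eqVneq c 0.
have := main (c^*%R / `|c|); rewrite normrM normfV norm_conjC normr_id.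
rewrite divff ?normr_eq0 // => /(_ erefl).
rewrite mulrAC [_ * c]mulrC -normCK expr2 mulfK ?normr_eq0 //.
rewrite (Creal_ReP _ _) ?normr_real // => cRe.
by rewrite -(ge_leif (leif_Re_Creal c)).
Qed.

(** The quotients (1 + t i) / (1 - t i) for natural t are infinitely many
unimodular numbers. *)
Lemma avoid_unimodular (rs : seq C) : exists2 mu, `|mu| = 1 & mu \notin rs.
Proof.
pose z (t : nat) : C := 1 + 'i%R * t%:R.
pose f t := z t / (z t)^*%R.
have zJ t : (z t)^*%R = 1 - 'i%R * t%:R.
  by rewrite rmorphD rmorphM /= conjC1 conjCi conjC_nat mulNr.
have z0 t : z t != 0.
  apply/eqP => /(congr1 (fun x => 'Re x)); rewrite Re_rect ?realn ?real1 // raddf0.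
  by apply/eqP; rewrite oner_eq0.
have fI : injective f.
  move=> t u /eqP; rewrite /f eqr_div ?conjC_eq0 // !zJ -subr_eq0.
  have -> : z t * (1 - 'i%R * u%:R) - z u * (1 - 'i%R * t%:R) =
    'i%R * 2 * (t%:R - u%:R) by rewrite /z; ring.
  rewrite !mulf_eq0 (negPf (neq0Ci C)) pnatr_eq0 /= subr_eq0 eqr_nat.
  by move/eqP.
have [/hasP[t _ ft]|/hasPn all_in] :=
  boolP (has (fun t => f t \notin rs) (iota 0 (size rs).+1)).
  by exists (f t); rewrite // normrM normfV norm_conjC divff // normr_eq0.
suff /uniq_leq_size : uniq (map f (iota 0 (size rs).+1)).
  move/(_ rs); rewrite size_map size_iota ltnn => H.
  have : false by apply: H => _ /mapP[t /all_in/negbNE ? ->].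
  by [].
by rewrite map_inj_uniq ?iota_uniq.
Qed.

(** If A = G^H G, then A B and the positive semidefinite G B G^H have the same
nonzero eigenvalues, and G B G^H = 0 only if A B = 0. *)
Lemma psd_mul_eigen n (A B : 'M[C]_n) : psd A -> psd B -> A *m B != 0 ->
  exists (c : C) (v : 'cV[C]_n), [/\ 0 < c, v != 0 & A *m B *m v = c *: v].
Proof.
move=> /psd_gramP[G AE] Bp AB0.
have Np : psd (G *m B *m G^H) by exact: psd_conj.
set N := G *m B *m G^H in Np.
have N0 : N != 0.
  have [K BE] := psd_gramP Bp; apply: contraNneq AB0; rewrite /N BE => K0.
  have : (K *m G^H)^H *m (K *m G^H) = 0.
    by rewrite adjmxM adjmxK !mulmxA -mulmxA in K0 *; rewrite -K0 !mulmxA.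
  move/adj_mulmx_eq0/(congr1 (@adjmx C _ _)); rewrite adjmxM adjmxK adjmx0 => GK.
  by rewrite AE !mulmxA -(mulmxA G^H) GK mulmx0 mul0mx.
have [d0 NE] := psd_spectral Np; have Su := spectral_unitarymx N.
set S := spectralmx N in NE Su; set d := spectral_diag N in d0 NE.
have [j dj] : exists j, d 0 j != 0.
  apply/existsP; apply: contraNT N0; rewrite negb_exists => /forallP d_0.
  have dE : d = 0 by apply/rowP=> j; rewrite mxE; apply/eqP/negbNE/d_0.
  by rewrite NE dE linear0 mulmx0 mul0mx.
pose w := S^H *m (delta_mx j 0 : 'cV_n).
have Nw : N *m w = d 0 j *: w.
  rewrite NE /w -!mulmxA (mulmxA S) (unitaryP Su) mul1mx scalemxAr.
  congr (_ *m _); apply/colP=> i; rewrite mul_diag_mx !mxE.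
  by case: eqVneq => [->|_]; rewrite ?mulr0 ?mulr1.
have w0 : w != 0.
  apply: contraTneq isT => w0; have : S *m w = 0 by rewrite w0 mulmx0.
  rewrite /w mulmxA (unitaryP Su) mul1mx => /colP/(_ j)/eqP.
  by rewrite !mxE !eqxx oner_eq0.
exists (d 0 j), (G^H *m w); split; first by rewrite lt_def dj d0.
- apply: contraNneq w0 => Gw; have : N *m w = 0 by rewrite -mulmxA Gw mulmx0.
  by rewrite Nw => /eqP; rewrite scaler_eq0 (negPf dj).
- by rewrite AE scalemxAr -Nw /N !mulmxA.
Qed.

End Maximizers.

Section Optimal.
Variables (C : numClosedFieldType) (k r s : nat).
Implicit Types (X Y : 'M[C]_(r, s)) (P : 'M[C]_(k, r)) (Q : 'M[C]_(k, s)).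

Definition maximizes P Q X :=
  [/\ P \is unitarymx, Q \is unitarymx &
      forall P' Q', P' \is unitarymx -> Q' \is unitarymx ->
        'Re (\tr (P' *m X *m Q'^H)) <= 'Re (\tr (P *m X *m Q^H))].

(** Multiplying P or Q by a unitary matrix on the right keeps the rows
orthonormal, so [psd_of_trace_max] applies on either side. *)
Lemma maximizes_psd P Q X : maximizes P Q X ->
  psd (Q^H *m P *m X) /\ psd (X *m Q^H *m P).
Proof.
case=> Pu Qu opt; split; apply: psd_of_trace_max => W Wu.
  rewrite -(mulmxA Q^H) mulmxA mxtrace_mulC [X in _ <= 'Re X]mxtrace_mulC.
  have -> : W *m Q^H = (Q *m W^H)^H by rewrite adjmxM adjmxK.
  by apply: opt => //; rewrite mul_unitarymx // [W^H \is _]trmxC_unitary.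
rewrite mulmxA mxtrace_mulC [X in _ <= 'Re X]mxtrace_mulC !mulmxA.
by apply: opt => //; rewrite mul_unitarymx.
Qed.

(** For Z = P^H Q both Z^H X and X Z^H are Hermitian, hence
X Z^H Z = Z X^H Z = Z Z^H X. *)
Lemma maximizes_comm P Q X : maximizes P Q X ->
  X *m (Q^H *m Q) = P^H *m P *m X.
Proof.
move=> PQX; have [/psd_herm H1 /psd_herm H2] := maximizes_psd PQX.
have [/unitaryP PP /unitaryP QQ _] := PQX.
rewrite !adjmxM !adjmxK !mulmxA in H1 H2.
have -> : X *m (Q^H *m Q) = X *m Q^H *m P *m P^H *m Q.
  by rewrite -!mulmxA (mulmxA P) PP mul1mx.
rewrite -H2 -(mulmxA _ X^H) -(mulmxA _ _ Q) -(mulmxA P^H) H1.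
by rewrite !mulmxA -(mulmxA P^H Q) QQ mulmx1.
Qed.

(** The direction v in the row space of Q contributes nothing to the trace.  If X
had a component outside the ranges of P^H P and Q^H Q, trading v for a
direction of that component would increase the trace. *)
Lemma maximizes_range P Q X (v : 'cV[C]_s) : maximizes P Q X ->
  v != 0 -> Q^H *m Q *m v = v -> Q^H *m P *m X *m v = 0 ->
  X = P^H *m P *m X.
Proof.
move=> PQX v0 Qv Xv; have [Pu Qu opt] := PQX.
have [/unitaryP PP /unitaryP QQ] := (Pu, Qu).
apply/eqP; rewrite -subr_eq0; apply: contraT => X0.
set E := P^H *m P in X0 Xv *; set F := Q^H *m Q in Qv *.
have EX : X *m F = E *m X by exact: maximizes_comm.
have PE : P *m E = P by rewrite mulmxA PP mul1mx.
have QF : Q *m F = Q by rewrite mulmxA QQ mul1mx.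
have EH : E^H = E by rewrite adjmxM adjmxK.
have FH : F^H = F by rewrite adjmxM adjmxK.
have XE : X - E *m X = (1%:M - E) *m X *m (1%:M - F).
  have EE : E *m E = E by rewrite -{1}[E]/(P^H *m P) -mulmxA PE.
  rewrite mulmxBl mul1mx mulmxBr mulmx1 mulmxBl -(mulmxA E X) EX.
  by rewrite (mulmxA E E) EE subrr subr0.
have /matrix0Pn[i [j Xij]] := X0.
pose x : 'rV_r := delta_mx 0 i *m (1%:M - E).
pose y : 'rV_s := delta_mx 0 j *m (1%:M - F).
have zE : (x *m X *m y^H) 0 0 = (X - E *m X) i j.
  by rewrite XE -(qform_delta _ i j) /x /y adjmxM adjmxB adjmx1 FH !mulmxA.
set z := _ i j in zE Xij.
have [x0 y0] : x != 0 /\ y != 0.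
  split; apply: contraNneq Xij => E0; rewrite -zE E0.
    by rewrite !mul0mx mxE.
  by rewrite adjmx0 mulmx0 mxE.
have Px : P *m x^H = 0.
  by rewrite adjmxM adjmxB adjmx1 EH mulmxA mulmxBr mulmx1 PE subrr mul0mx.
have Qy : Q *m y^H = 0.
  by rewrite adjmxM adjmxB adjmx1 FH mulmxA mulmxBr mulmx1 QF subrr mul0mx.
(* Trading the row a T for a unit row u orthogonal to the rows of T keeps the
   rows orthonormal. *)
have swap n (T : 'M[C]_(k, n)) (a : 'rV_k) (u : 'rV_n) :
    T \is unitarymx -> a \is unitarymx -> u \is unitarymx -> T *m u^H = 0 ->
    (1%:M - a^H *m a) *m T + a^H *m u \is unitarymx.
  move=> /unitaryP TT /unitaryP aa /unitaryP uu Tu; apply/unitaryP.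
  have uT := mulmx_adjC0 Tu.
  have MH : (1%:M - a^H *m a)^H = 1%:M - a^H *m a.
    by rewrite adjmxB adjmx1 adjmxM adjmxK.
  have MM : (1%:M - a^H *m a) *m (1%:M - a^H *m a) = 1%:M - a^H *m a.
    rewrite mulmxBl mul1mx mulmxBr mulmx1 -mulmxA (mulmxA a) aa mul1mx.
    by rewrite subrr subr0.
  rewrite adjmxD !adjmxM adjmxK MH.
  move: (1%:M - _) MM (subrK (a^H *m a) 1%:M) {MH} => M MM M1.
  rewrite mulmxDl !mulmxDr -!mulmxA (mulmxA T T^H) TT mul1mx MM.
  rewrite (mulmxA T u^H) Tu mul0mx mulmx0 addr0 (mulmxA u T^H) uT mul0mx mulmx0.
  by rewrite add0r (mulmxA u u^H) uu mul1mx.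
have vQ : v^H *m Q^H != 0.
  apply: contraNneq v0 => vQ; rewrite -Qv -mulmxA.
  by rewrite -[Q *m v]adjmxK adjmxM vQ adjmx0 mulmx0.
have [ta ta0 au] := unit_row vQ.
have [tx tx0 xu] := unit_row x0; have [ty ty0 yu] := unit_row y0.
set a := ta *: _ in au; set u1 := tx *: x in xu.
have z0 : `|z| != 0 by rewrite normr_eq0.
(* This phase makes the gained term u1 X v1^H positive. *)
pose ph := z / `|z|.
have phu : ph *: (ty *: y) \is unitarymx.
  have /unitaryP yy := yu; apply/unitaryP; rewrite adjmxZ -scalemxAl -scalemxAr.
  rewrite yy scalerA -normCK normrM normfV normr_id divff //.
  by rewrite expr1n scale1r.
set v1 := ph *: _ in phu.
have Pu1 : P *m u1^H = 0 by rewrite adjmxZ -scalemxAr Px scaler0.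
have Qv1 : Q *m v1^H = 0 by rewrite !adjmxZ -!scalemxAr Qy !scaler0.
have uXv : (u1 *m X *m v1^H) 0 0 = tx * ty * `|z|.
  rewrite /u1 /v1 !adjmxZ -!scalemxAl -!scalemxAr !scalemxE zE.
  rewrite (conj_Creal (gtr0_real ty0)) rmorphM /= fmorphV /=.
  rewrite (conj_Creal (normr_real z)).
  transitivity (tx * ty * ((z * z^*%R) / `|z|)); first by field.
  by rewrite -normCK expr2 mulfK.
have PXv : P *m X *m v = 0.
  have : Q *m (Q^H *m P *m X *m v) = 0 by rewrite Xv mulmx0.
  by rewrite !mulmxA QQ mul1mx.
have PXa : P *m X *m Q^H *m a^H = 0.
  rewrite /a adjmxZ adjmxM !adjmxK -scalemxAr -(mulmxA (P *m X)) (mulmxA Q^H).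
  by rewrite Qv PXv scaler0.
have aM : a *m (1%:M - a^H *m a) = 0.
  by rewrite mulmxBr mulmx1 mulmxA (unitaryP au) mul1mx subrr.
have := opt _ _ (swap _ _ _ _ Pu au xu Pu1) (swap _ _ _ _ Qu au phu Qv1).
have MH : (1%:M - a^H *m a)^H = 1%:M - a^H *m a.
  by rewrite adjmxB adjmx1 adjmxM adjmxK.
have MM : (1%:M - a^H *m a) *m (1%:M - a^H *m a) = 1%:M - a^H *m a.
  by rewrite {1}mulmxBl mul1mx -mulmxA aM mulmx0 subr0.
have PXM : P *m X *m Q^H *m (1%:M - a^H *m a) = P *m X *m Q^H.
  by rewrite mulmxBr mulmx1 mulmxA PXa mul0mx subr0.
move: (1%:M - _) aM MH MM PXM => M aM MH MM PXM.
have Ma : M *m a^H = 0 by rewrite -MH -adjmxM aM adjmx0.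
rewrite [X in 'Re (\tr X)](_ : _ = M *m P *m X *m Q^H *m M +
    M *m (P *m X *m v1^H) *m a + a^H *m (u1 *m X *m Q^H) *m M +
    a^H *m (u1 *m X *m v1^H) *m a); last first.
  rewrite adjmxD !adjmxM adjmxK MH !(mulmxDl, mulmxDr) !mulmxA.
  by rewrite addrACA !addrA.
rewrite !raddfD /=.
have -> : \tr (M *m (P *m X *m v1^H) *m a) = 0.
  by rewrite mxtrace_mulC mulmxA aM mul0mx raddf0.
have -> : \tr (a^H *m (u1 *m X *m Q^H) *m M) = 0.
  by rewrite mxtrace_mulC mulmxA Ma mul0mx raddf0.
have -> : \tr (a^H *m (u1 *m X *m v1^H) *m a) = tx * ty * `|z|.
  rewrite -(mulmxA _ _ a) mxtrace_mulC -(mulmxA _ a) (unitaryP au) mulmx1.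
  by rewrite trace_mx11 uXv.
have -> : \tr (M *m P *m X *m Q^H *m M) = \tr (P *m X *m Q^H).
  by rewrite mxtrace_mulC !mulmxA MM -!mulmxA mxtrace_mulC !mulmxA PXM.
rewrite !raddf0 !addr0 gerDl => /le_gtF/negbT/negP[].
have pos : 0 < tx * ty * `|z| by rewrite !mulr_gt0 // lt_def z0 normr_ge0.
by rewrite (Creal_ReP _ _) // gtr0_real.
Qed.

(** For all mu, conj mu A B is the restriction of X^H Y to the row space of Q, so
a positive eigenvalue of A B gives an eigenvalue of X^H Y with the phase of
conj mu.  Only finitely many phases are possible; for any other mu, A B = 0,
and then [maximizes_range] confines X and Y to the row spaces of P and Q. *)
Lemma orth_of_phases X Y :
  (forall mu, `|mu| = 1 -> exists P Q,
     [/\ maximizes P Q X, maximizes P Q (mu *: Y),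
         \tr (P *m X *m Q^H) != 0 & \tr (P *m Y *m Q^H) != 0]) ->
  [/\ X^H *m Y = 0, X *m Y^H = 0 &
      exists2 mu, `|mu| = 1 & (\rank (X + mu *: Y)%R <= k)%N].
Proof.
move=> ex; set T := X^H *m Y.
have [rs charE] := closed_field_poly_normal (char_poly T^T).
(* [eigenvalue] refers to row vectors, hence the transpose of T; mu is chosen
   such that no positive multiple of its conjugate is a root. *)
have [mu mu1 mu_rs] := avoid_unimodular [seq (l / `|l|)^*%R | l <- rs].
have [P [Q [PQX PQY trX trY]]] := ex mu mu1.
have [/unitaryP PP /unitaryP QQ _] := PQX.
have [Ap _] := maximizes_psd PQX; have [Bp _] := maximizes_psd PQY.
set A := Q^H *m P *m X in Ap; set B := Q^H *m P *m (mu *: Y) in Bp.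
have [AH BH] := (psd_herm Ap, psd_herm Bp).
have mumu : mu^*%R * mu = 1 by rewrite mulrC -normCK mu1 expr1n.
have QA : Q^H *m Q *m A = A by rewrite !mulmxA -(mulmxA _ Q) QQ mulmx1.
have QB : Q^H *m Q *m B = B by rewrite !mulmxA -(mulmxA _ Q) QQ mulmx1.
have TQ : T *m (Q^H *m Q) = mu^*%R *: (A *m B).
  have YQ : mu *: Y *m (Q^H *m Q) = P^H *m P *m (mu *: Y).
    exact: maximizes_comm.
  have -> : T *m (Q^H *m Q) = mu^*%R *: (X^H *m (mu *: Y *m (Q^H *m Q))).
    by rewrite -scalemxAl -scalemxAr scalerA mumu scale1r !mulmxA.
  rewrite YQ -AH /A !adjmxM adjmxK /B !mulmxA; congr (_ *: _).
  by rewrite -!mulmxA (mulmxA Q Q^H) QQ mul1mx.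
have AB0 : A *m B = 0.
  apply/eqP; apply: contraT => /(psd_mul_eigen Ap Bp)[c [v [c0 v0 ABv]]].
  have Qv : Q^H *m Q *m v = v.
    apply: (@scalerI _ _ c); first by rewrite gt_eqF.
    by rewrite scalemxAr -ABv (mulmxA _ (A *m B)) (mulmxA _ A B) QA.
  have Tv : T *m v = (mu^*%R * c) *: v.
    by rewrite -{1}Qv mulmxA TQ -scalemxAl ABv scalerA.
  have : eigenvalue T^T (mu^*%R * c).
    apply/eigenvalueP; exists v^T; last by rewrite trmx_eq0.
    by rewrite -trmx_mul Tv linearZ.
  rewrite eigenvalue_root_char charE rootZ ?root_prod_XsubC; last first.
    by rewrite (monicP (char_poly_monic _)) oner_eq0.
  move=> lrs; case/negP: mu_rs; apply/mapP; exists (mu^*%R * c) => //.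
  rewrite normrM norm_conjC mu1 mul1r gtr0_norm //.
  by rewrite mulfK ?gt_eqF // conjCK.
have BA0 : B *m A = 0 by rewrite -AH -BH -adjmxM AB0 adjmx0.
have trE Z : \tr (P *m Z *m Q^H) = \tr (Q^H *m P *m Z).
  by rewrite mxtrace_mulC mulmxA.
have YE : Y = mu^*%R *: (mu *: Y) by rewrite scalerA mumu scale1r.
have A0 : A != 0 by apply: contraNneq trX; rewrite trE -/A => ->; rewrite raddf0.
have B0 : B != 0.
  apply: contraNneq trY => B0.
  by rewrite trE YE -scalemxAr -/B B0 scaler0 raddf0.
have range Z (D1 D2 : 'M_s) : maximizes P Q Z -> D1 = Q^H *m P *m Z -> D2 != 0 ->
    Q^H *m Q *m D2 = D2 -> D1 *m D2 = 0 -> Z = P^H *m Q *m D1.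
  move=> PQZ -> /matrix0Pn[i [j Dij]] QD D12.
  have v0 : col j D2 != 0.
    by apply: contraNneq Dij => /colP/(_ i); rewrite !mxE => ->.
  rewrite {1}(maximizes_range PQZ v0) ?(mulmxA _ (Q^H)).
  - by rewrite -!mulmxA (mulmxA Q Q^H) QQ mul1mx.
  - by rewrite !colE mulmxA QD.
  - by rewrite colE mulmxA D12 mul0mx.
have XE := range _ _ _ PQX (erefl A) B0 QB AB0.
have mYE := range _ _ _ PQY (erefl B) A0 QA BA0.
have ZZ : Q^H *m P *m (P^H *m Q) = Q^H *m Q.
  by rewrite !mulmxA -(mulmxA _ P) PP mulmx1.
have XY : X^H *m (mu *: Y) = 0.
  rewrite mYE XE adjmxM AH adjmxM adjmxK -(mulmxA A) (mulmxA (Q^H *m P)) ZZ.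
  by rewrite QB.
have XYH : X *m (mu *: Y)^H = 0.
  rewrite mYE XE adjmxM BH -(mulmxA _ A) (mulmxA A B) AB0.
  by rewrite mul0mx mulmx0.
split.
- by rewrite /T YE -scalemxAr XY scaler0.
- by rewrite YE adjmxZ -scalemxAr XYH scaler0.
exists mu => //; have -> : X + mu *: Y = P^H *m (Q *m (A + B)).
  by rewrite mulmxA mulmxDr -XE -mYE.
by apply: leq_trans (mxrankM_maxl _ _) (rank_leq_col _).
Qed.

End Optimal.

(** * The structure of families with orthogonality relations *)

Section DisjointFamilies.
Variable C : numClosedFieldType.

Definition orth r s (X Y : 'M[C]_(r, s)) := X^H *m Y = 0 /\ X *m Y^H = 0.

(** If T i j = Phi (E_ij) and Phi maps orthogonal matrices of rank one to
orthogonal matrices, these relations come from the matrices x^H y with x one of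
e_i, e_i + e_k, e_i - e_k, and y one of e_j, e_j + e_l, e_j - e_l. *)
Definition disjoint_family m n r s (T : 'I_m -> 'I_n -> 'M[C]_(r, s)) :=
  forall i k j l, i != k -> j != l ->
  [/\ orth (T i j) (T k l),
      orth (T i j + T k j) (T i l - T k l),
      orth (T i j + T i l) (T k j - T k l) &
      orth (T i j + T i l + T k j + T k l) (T i j - T i l - T k j + T k l)].

(** Exchanging the two indices and taking adjoints preserve the relations, so
that an identity proved for all families holds in four symmetric forms. *)
Definition swapf m n r s (T : 'I_m -> 'I_n -> 'M[C]_(r, s)) j i := T i j.
Definition adjf m n r s (T : 'I_m -> 'I_n -> 'M[C]_(r, s)) i j := (T i j)^H.

Lemma disjoint_swap m n r s (T : 'I_m -> 'I_n -> 'M[C]_(r, s)) :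
  disjoint_family T -> disjoint_family (swapf T).
Proof.
move=> dT j l i k jl ik; have [o1 o2 o3 o4] := dT i k j l ik jl.
split=> //; rewrite /swapf.
by rewrite [T i j + T k j + _]addrAC [T i j - T k j - _]addrAC.
Qed.

Lemma disjoint_adj m n r s (T : 'I_m -> 'I_n -> 'M[C]_(r, s)) :
  disjoint_family T -> disjoint_family (adjf T).
Proof.
have oadj (X Y : 'M[C]_(r, s)) : orth X Y -> orth X^H Y^H.
  by case=> XY YX; split; rewrite adjmxK.
move=> dT i k j l ik jl; have [o1 o2 o3 o4] := dT i k j l ik jl.
by split; rewrite /adjf -?(adjmxN, adjmxD); apply: oadj.
Qed.

Lemma disjoint0 m n r s (T : 'I_m -> 'I_n -> 'M[C]_(r, s)) i k j l :
  disjoint_family T -> i != k -> j != l -> (T i j)^H *m T k l = 0.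
Proof. by move=> dT ik jl; have [[]] := dT _ _ _ _ ik jl. Qed.

Lemma disjoint_row m n r s (T : 'I_m -> 'I_n -> 'M[C]_(r, s)) i k j l :
  disjoint_family T -> j != l ->
  (T i j)^H *m T i l = (T k j)^H *m T k l.
Proof.
move=> dT jl; have [->//|ik] := eqVneq i k.
have [_ [o _] _ _] := dT _ _ _ _ ik jl; move/eqP: o.
rewrite adjmxD mulmxDl !mulmxBr (disjoint0 dT ik jl) subr0.
have ki : k != i by rewrite eq_sym.
by rewrite (disjoint0 dT ki jl) sub0r subr_eq0 => /eqP.
Qed.

Lemma disjoint_col m n r s (T : 'I_m -> 'I_n -> 'M[C]_(r, s)) i k j l :
  disjoint_family T -> i != k ->
  (T i j)^H *m T k j = (T i l)^H *m T k l.
Proof.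
by move=> dT ik; have := disjoint_row j l (disjoint_swap dT) ik.
Qed.

(** In the expansion of the relation between sum and difference, the mixed terms
cancel in pairs by [disjoint_row] and [disjoint_col]. *)
Lemma disjoint_diag m n r s (T : 'I_m -> 'I_n -> 'M[C]_(r, s)) i k j l :
  disjoint_family T ->
  (T i j)^H *m T i j + (T k l)^H *m T k l =
  (T i l)^H *m T i l + (T k j)^H *m T k j.
Proof.
move=> dT; have [->|ik] := eqVneq i k; first by rewrite addrC.
have [->//|jl] := eqVneq j l.
have [_ _ _ [o _]] := dT _ _ _ _ ik jl.
have lj : l != j by rewrite eq_sym.
have ki : k != i by rewrite eq_sym.
move/eqP: o; rewrite !adjmxD !(mulmxDl, mulmxDr, mulmxN).
rewrite !(disjoint0 dT ik jl, disjoint0 dT ki jl).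
rewrite !(disjoint0 dT ik lj, disjoint0 dT ki lj) !(oppr0, addr0, add0r).
rewrite (disjoint_row i k dT jl) (disjoint_row i k dT lj).
rewrite (disjoint_col j l dT ik) (disjoint_col j l dT ki).
move=> /eqP o; apply/matrixP=> x y; apply/eqP; rewrite -subr_eq0.
move/matrixP/(_ x y): o; rewrite !(addmxE, oppmxE) [RHS]mxE => <-.
by apply/eqP; ring.
Qed.

(** The vector x = H w - c w satisfies H x = - c x, and - c < 0 cannot be an
eigenvalue of H. *)
Lemma psd_sqrt_eigen n (H : 'M[C]_n) c (w : 'cV[C]_n) : psd H -> 0 < c ->
  H *m (H *m w) = (c * c) *: w -> H *m w = c *: w.
Proof.
move=> Hp c0 HHw; apply/eqP; rewrite -subr_eq0; set x := _ - _.
have Hx : H *m x = - c *: x.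
  rewrite /x mulmxBr HHw -scalemxAr scalerBr scalerA scaleNr mulNr scaleNr.
  by rewrite opprK addrC.
have := Hp x^H; rewrite adjmxK -mulmxA Hx -scalemxAr scalemxE mulNr oppr_ge0.
rewrite pmulr_rle0 // => xx.
have x0 : (x^H *m x) 0 0 = 0.
  by apply/eqP; rewrite eq_le xx -{2}[x]adjmxK gram_diag_ge0.
by apply/eqP/adj_mulmx_eq0; rewrite [LHS]mx11_scalar x0 raddf0.
Qed.

Lemma psd_sqrt_eigenmx n q (H : 'M[C]_n) (e : 'rV[C]_q) (W : 'M[C]_(n, q)) :
  psd H -> (forall j, 0 < e 0 j) ->
  H *m (H *m W) = W *m diag_mx e *m diag_mx e -> H *m W = W *m diag_mx e.
Proof.
move=> Hp e0 HHW; apply/matrixP=> i j.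
have colD (A : 'M[C]_(n, q)) k : col k (A *m diag_mx e) = e 0 k *: col k A.
  by apply/colP=> l; rewrite mul_mx_diag !mxE mulrC.
have : col j (H *m W) = col j (W *m diag_mx e).
  rewrite colD colE -mulmxA -colE; apply: psd_sqrt_eigen => //.
  by rewrite -scalerA -!colD -HHW !colE !mulmxA.
by move/colP/(_ i); rewrite !mxE.
Qed.

Lemma psd_compact n (N : 'M[C]_n) : psd N ->
  exists (q : nat) (W : 'M[C]_(q, n)) (d : 'rV[C]_q),
    [/\ W \is unitarymx, forall j, 0 < d 0 j & N = W^H *m diag_mx d *m W].
Proof.
move=> Np; have [d0 NE] := psd_spectral Np; have Su := spectral_unitarymx N.
set S := spectralmx N in NE Su; set d := spectral_diag N in d0 NE.
pose J := [set j | d 0 j != 0]; pose f (a : 'I_#|J|) : 'I_n := enum_val a.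
exists #|J|, (rowsub f S), (\row_a d 0 (f a)); split.
- exact/unitary_rowsub/Su/enum_val_inj.
- by move=> a; have := enum_valP a; rewrite inE mxE lt_def d0 => ->.
rewrite NE; apply/matrixP=> i j; rewrite -!mulmxA !mxE.
rewrite (bigID (fun a => a \in J)) /= [X in _ + X]big1 => [|a].
  rewrite addr0 big_enum_val; apply: eq_bigr => a _.
  by rewrite !adjmxE !mul_diag_mx !mxE.
by rewrite inE negbK mul_diag_mx [in X in _ * X]mxE => /eqP->; rewrite mul0r mulr0.
Qed.

Lemma adj_diag_pos q (e : 'rV[C]_q) : (forall j, 0 < e 0 j) ->
  (diag_mx e)^H = diag_mx e.
Proof. by move=> e0; apply: adj_diag_ge0 => j; exact: ltW. Qed.

Lemma diag_pos_unit q (e : 'rV[C]_q) : (forall j, 0 < e 0 j) ->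
  diag_mx e \in unitmx.
Proof.
move=> e0; rewrite unitmxE det_diag unitfE; apply/prodf_neq0 => j _.
by rewrite gt_eqF.
Qed.

Lemma adj_invmx n (A : 'M[C]_n) : (invmx A)^H = invmx A^H.
Proof. by rewrite /adjmx -map_invmx trmx_inv. Qed.

(** In the model T i j = E_ij (x) D (+) E_ji (x) D', the matrices U i and V j embed
the i-th and the j-th copy of the space on which D acts, in the first
summand. *)
Definition frame m n r s (T : 'I_m -> 'I_n -> 'M[C]_(r, s)) q (D : 'M[C]_q)
    (U : 'I_m -> 'M[C]_(r, q)) (V : 'I_n -> 'M[C]_(s, q)) :=
  [/\ forall i j l, T i j *m V l = if j == l then U i *m D else 0,
      forall i j k, (T i j)^H *m U k = if i == k then V j *m D else 0,
      forall i k, (U i)^H *m U k = (i == k)%:R%:M &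
      forall j l, (V j)^H *m V l = (j == l)%:R%:M].

Section Frame.
Variables (m n r s : nat) (T : 'I_m -> 'I_n -> 'M[C]_(r, s)).
Hypothesis dT : disjoint_family T.
Variables (i0 i1 : 'I_m) (j0 j1 : 'I_n).
Hypotheses (i01 : i0 != i1) (j01 : j0 != j1).

Let dTa := disjoint_adj dT.

Lemma exists_neq i : exists k : 'I_m, k != i.
Proof.
by have [->|] := eqVneq i i0; [exists i1|exists i0]; rewrite eq_sym.
Qed.

Lemma Tadj0 i k j l : i != k -> j != l -> T i j *m (T k l)^H = 0.
Proof. by move=> ik jl; have := disjoint0 dTa ik jl; rewrite /adjf adjmxK. Qed.

Lemma Tadj_row i k j l : j != l -> T i j *m (T i l)^H = T k j *m (T k l)^H.
Proof. by move=> jl; have := disjoint_row i k dTa jl; rewrite /adjf !adjmxK. Qed.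

Lemma Tadj_diag i k j l :
  T i j *m (T i j)^H + T k l *m (T k l)^H =
  T i l *m (T i l)^H + T k j *m (T k j)^H.
Proof. by have := disjoint_diag i k j l dTa; rewrite /adjf !adjmxK. Qed.

(* In the model E_ij (x) D (+) E_ji (x) D', the matrix H is
   E_00 (x) D^2 (+) E_00 (x) D'^2; P1 and P2 are the two summands of H^2. *)
Let P1 := (T i0 j0)^H *m T i0 j1 *m (T i0 j1)^H *m T i0 j0.
Let P2 := (T i0 j0)^H *m T i1 j0 *m (T i1 j0)^H *m T i0 j0.
Let H := (T i0 j0)^H *m T i0 j0.

Lemma square_corner : H *m H = P1 + P2.
Proof.
have E := Tadj_diag i0 i1 j0 j1.
have := congr1 (fun X => (T i0 j0)^H *m X *m T i0 j0) E.
rewrite !(mulmxDl, mulmxDr) !mulmxA (disjoint0 dT i01 j01) !mul0mx addr0.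
by [].
Qed.

Lemma corner_orth : P2 *m P1 = 0.
Proof.
have i10 : i1 != i0 by rewrite eq_sym.
have E1 := disjoint_col j0 j1 dT i10.
have j10 : j1 != j0 by rewrite eq_sym.
rewrite /P2 /P1 -!mulmxA (mulmxA (T i1 j0)^H) E1 -!mulmxA.
rewrite (mulmxA (T i0 j1) (T i0 j0)^H) (Tadj_row i0 i1 j10) -!mulmxA.
by rewrite (mulmxA (T i1 j0)^H) (disjoint0 dT i10 j01) mul0mx !mulmx0.
Qed.

(** The columns of V j0 are an orthonormal basis of the range of P1 made of
eigenvectors; T i j and its adjoint carry them to all U i and all other V j.  The last property says
that T i l^H T i j, which sees the first summand of the model only, vanishes on
the orthogonal complement of the frame. *)
Lemma frame_exists :
  exists (q : nat) (e : 'rV[C]_q) (U : 'I_m -> 'M[C]_(r, q))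
      (V : 'I_n -> 'M[C]_(s, q)),
    [/\ forall a, 0 < e 0 a, frame T (diag_mx e) U V &
        forall p (z : 'M[C]_(s, p)), (forall j, (V j)^H *m z = 0) ->
          forall i j, exists2 l, l != j & (T i l)^H *m T i j *m z = 0].
Proof.
have i10 : i1 != i0 by rewrite eq_sym.
have j10 : j1 != j0 by rewrite eq_sym.
have P1p : psd P1.
  have -> : P1 = ((T i0 j1)^H *m T i0 j0)^H *m ((T i0 j1)^H *m T i0 j0).
    by rewrite adjmxM adjmxK /P1 !mulmxA.
  exact: psd_gram.
have [q [W [d [/unitaryP WW d0 PE]]]] := psd_compact P1p.
(* P1 is the fourth power of the scaling in the model. *)
pose f := map_mx sqrtC d; pose e := map_mx sqrtC f.
have f0 a : 0 < f 0 a by rewrite mxE sqrtC_gt0.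
have e0 a : 0 < e 0 a by rewrite mxE sqrtC_gt0.
pose D := diag_mx e; pose E := invmx D.
have DE : D *m E = 1%:M by rewrite mulmxV // diag_pos_unit.
have ED : E *m D = 1%:M by rewrite mulVmx // diag_pos_unit.
have DH : D^H = D by exact: adj_diag_pos.
have DD : D *m D = diag_mx f by exact: sqrt_diagK.
have FF : diag_mx f *m diag_mx f = diag_mx d by exact: sqrt_diagK.
have EH : E^H = E by rewrite adj_invmx DH.
pose V0 := W^H.
have VV : V0^H *m V0 = 1%:M by rewrite adjmxK.
have P1V : P1 *m V0 = V0 *m diag_mx d.
  by rewrite PE -mulmxA WW mulmx1.
have kill p (K : 'M[C]_(p, s)) : K *m P1 = 0 -> K *m V0 = 0.
  move=> KP; have KVd : K *m V0 *m diag_mx d = 0.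
    by rewrite -mulmxA -P1V mulmxA KP mul0mx.
  by rewrite -[LHS](mulmxK (diag_pos_unit d0)) KVd mul0mx.
have Hp : psd H by exact: psd_gram.
(* V0 consists of eigenvectors of H^2, hence of H. *)
have HV : H *m V0 = V0 *m D *m D.
  rewrite -mulmxA DD; apply: psd_sqrt_eigenmx => //.
  rewrite -mulmxA FF mulmxA square_corner mulmxDl P1V (kill _ P2) ?addr0 //.
  exact: corner_orth.
have TV0 i l : l != j0 -> T i l *m V0 = 0.
  move=> lj; have jl : j0 != l by rewrite eq_sym.
  apply: kill; rewrite /P1 !mulmxA.
  have [->|ii] := eqVneq i i0; last by rewrite Tadj0 // !mul0mx.
  rewrite (Tadj_row i0 i1 lj) -!mulmxA (mulmxA (T i1 j0)^H).
  by rewrite (disjoint0 dT i10 j01) mul0mx !mulmx0.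
have NV0 i k : i != k -> (T i j0)^H *m T k j0 *m V0 = 0.
  by move=> ik; rewrite (disjoint_col j0 j1 dT ik) -mulmxA TV0 ?mulmx0.
have HV0 i : (T i j0)^H *m T i j0 *m V0 = V0 *m D *m D.
  rewrite -HV /H; have := congr1 (mulmx^~ V0) (disjoint_diag i i0 j0 j1 dT).
  by rewrite !mulmxDl -!mulmxA !(TV0 _ _ j10) !mulmx0 addr0 add0r.
(* U and V are introduced through their equations only, to keep rewriting with
   associativity from unfolding them. *)
have [U UE] : exists U : 'I_m -> 'M_(r, q), forall i, U i = T i j0 *m V0 *m E.
  by exists (fun i => T i j0 *m V0 *m E).
have [V VE0] : exists V : 'I_n -> 'M_(s, q),
    forall j, V j = (T i0 j)^H *m U i0 *m E.
  by exists (fun j => (T i0 j)^H *m U i0 *m E).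
have VV0 : V j0 = V0.
  by rewrite VE0 UE !mulmxA HV0 -!mulmxA (mulmxA D E) DE mul1mx DE mulmx1.
have UD i : U i *m D = T i j0 *m V0 by rewrite UE -!mulmxA ED mulmx1.
have VD j : V j *m D = (T i0 j)^H *m U i0 by rewrite VE0 -!mulmxA ED mulmx1.
have TU i j k : (T i j)^H *m U k = if i == k then V j *m D else 0.
  rewrite UE !mulmxA; have [<-|ik] := eqVneq i k.
    have [->|jj] := eqVneq j j0.
      by rewrite VV0 HV0 -!mulmxA DE mulmx1.
    by rewrite VD UE !mulmxA (disjoint_row i i0 dT jj).
  have [->|jj] := eqVneq j j0; first by rewrite NV0 // mul0mx.
  by rewrite (disjoint0 dT) // !mul0mx.
have VE k j : V j = (T k j)^H *m U k *m E by rewrite TU eqxx -mulmxA DE mulmx1.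
have TV i j l : T i j *m V l = if j == l then U i *m D else 0.
  have [k ki] := exists_neq i; have ik : i != k by rewrite eq_sym.
  have [<-|jl] := eqVneq j l; last first.
    by rewrite (VE k) !mulmxA Tadj0 // !mul0mx.
  have [->|jj] := eqVneq j j0; first by rewrite VV0 UD.
  have := congr1 (mulmx^~ (U i)) (Tadj_diag i k j j0).
  rewrite !mulmxDl -!mulmxA !TU eqxx (negPf ki) !mulmx0 !addr0.
  move/(congr1 (mulmx^~ E)); rewrite -!mulmxA DE !mulmx1 => ->.
  by rewrite VV0 UD.
have UU i k : (U i)^H *m U k = (i == k)%:R%:M.
  rewrite {1}UE !adjmxM EH -!mulmxA TU; case: eqVneq => _.
    by rewrite VV0 (mulmxA V0^H) VV mul1mx ED.
  by rewrite !mulmx0 raddf0.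
have VVd j l : (V j)^H *m V l = (j == l)%:R%:M.
  rewrite {1}VE0 !adjmxM EH adjmxK -!mulmxA TV; case: eqVneq => _.
    by rewrite (mulmxA (U i0)^H) UU eqxx mul1mx ED.
  by rewrite !mulmx0 raddf0.
exists q, e, U, V; split=> // p z Vz i j.
have [k ki] := exists_neq i.
have V0z : V0^H *m z = 0 by rewrite -VV0.
have P1z : P1 *m z = 0 by rewrite PE -[W]adjmxK -mulmxA -/V0 V0z mulmx0.
have [->|jj] := eqVneq j j0.
  exists j1 => //; rewrite (disjoint_row i i0 dT j10).
  apply: adj_mulmx_eq0; rewrite !adjmxM !adjmxK -!mulmxA.
  by move: P1z; rewrite /P1 -!mulmxA => ->; rewrite mulmx0.
exists j0; first by rewrite eq_sym.
have j0j : j0 != j by rewrite eq_sym.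
rewrite (disjoint_row i i0 dT j0j); set M := (T i0 j0)^H *m T i0 j.
have MM : M *m M^H = P1.
  have := congr1 (fun X => (T i0 j0)^H *m X *m T i0 j0) (Tadj_diag i0 i1 j0 j).
  rewrite !(mulmxDl, mulmxDr) !mulmxA (disjoint0 dT i01 j0j) !mul0mx addr0.
  rewrite -(mulmxA _ (T i0 j0)^H) -/H square_corner -/P2 => /addIr ->.
  by rewrite adjmxM adjmxK !mulmxA.
(* M M^H = P1 has its range in that of V0, hence so has M. *)
have VM : V0 *m V0^H *m M = M.
  apply/esym/eqP; rewrite -subr_eq0 -{1}[M]mul1mx -mulmxBl.
  apply/eqP/mulmx_adj_eq0; rewrite adjmxM mulmxA -(mulmxA _ M) MM PE.
  rewrite -[X in _ *m (_ *m X)]adjmxK -/V0 2!mulmxA mulmxBl mul1mx.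
  by rewrite -(mulmxA V0) VV mulmx1 subrr !mul0mx.
have MV : M^H *m V0 = V j *m D *m D.
  by rewrite adjmxM adjmxK -mulmxA -UD mulmxA -VD.
have -> : M = V0 *m D *m (D *m (V j)^H).
  rewrite -VM -mulmxA; have -> : V0^H *m M = (M^H *m V0)^H.
    by rewrite adjmxM adjmxK.
  by rewrite MV !adjmxM DH !mulmxA.
by rewrite -!mulmxA Vz !mulmx0.
Qed.

End Frame.

(** The frame of the transposed family provides the second summand.  On a vector z
orthogonal to both frames, T i l^H T i j and T k j^H T i j vanish for some l and
k; by the diagonal relation (T i j^H T i j)^2 z = 0, so that T i j z = 0. *)
Lemma frame_decomposition m n r s (T : 'I_m -> 'I_n -> 'M[C]_(r, s))
    (i0 i1 : 'I_m) (j0 j1 : 'I_n) :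
  disjoint_family T -> i0 != i1 -> j0 != j1 ->
  exists (q1 q2 : nat) (e1 : 'rV[C]_q1) (e2 : 'rV[C]_q2)
    (U1 : 'I_m -> 'M[C]_(r, q1)) (V1 : 'I_n -> 'M[C]_(s, q1))
    (U2 : 'I_n -> 'M[C]_(r, q2)) (V2 : 'I_m -> 'M[C]_(s, q2)),
  [/\ (forall a, 0 < e1 0 a) /\ (forall a, 0 < e2 0 a),
      (forall i k, (U1 i)^H *m U1 k = (i == k)%:R%:M) /\
      (forall j l, (V1 j)^H *m V1 l = (j == l)%:R%:M),
      (forall j l, (U2 j)^H *m U2 l = (j == l)%:R%:M) /\
      (forall i k, (V2 i)^H *m V2 k = (i == k)%:R%:M),
      (forall i j, (U1 i)^H *m U2 j = 0) /\ (forall j i, (V1 j)^H *m V2 i = 0) &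
      forall i j, T i j = U1 i *m diag_mx e1 *m (V1 j)^H +
                          U2 j *m diag_mx e2 *m (V2 i)^H].
Proof.
move=> dT i01 j01; have dTs := disjoint_swap dT.
have [q1 [e1 [U1 [V1 [e10 [TV1 TU1 UU1 VV1] K1]]]]] := frame_exists dT i01 j01.
have [q2 [e2 [U2 [V2 [e20 [TV2 TU2 UU2 VV2] K2]]]]] := frame_exists dTs j01 i01.
exists q1, q2, e1, e2, U1, V1, U2, V2.
have U1D i : U1 i *m diag_mx e1 = T i j0 *m V1 j0 by rewrite TV1 eqxx.
have V1D k j : V1 j *m diag_mx e1 = (T k j)^H *m U1 k by rewrite TU1 eqxx.
have cancelD q (e : 'rV[C]_q) p (X : 'M[C]_(q, p)) : (forall a, 0 < e 0 a) ->
    diag_mx e *m X = 0 -> X = 0.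
  by move=> e0 eX; rewrite -[X](mulKmx (diag_pos_unit e0)) eX mulmx0.
have U12 i j : (U1 i)^H *m U2 j = 0.
  have [l lj] := exists_neq j01 j; have jl : j != l by rewrite eq_sym.
  apply: (cancelD _ _ _ _ e10); rewrite mulmxA -{1}(adj_diag_pos e10) -adjmxM.
  have -> : U1 i *m diag_mx e1 = T i l *m V1 l by rewrite TV1 eqxx.
  by rewrite adjmxM -mulmxA [_ *m U2 j]TU2 (negPf lj) mulmx0.
have V12 j i : (V1 j)^H *m V2 i = 0.
  have [k ki] := exists_neq i01 i.
  apply: (cancelD _ _ _ _ e10); rewrite mulmxA -{1}(adj_diag_pos e10) -adjmxM.
  by rewrite (V1D k) adjmxM adjmxK -mulmxA [_ *m V2 i]TV2 (negPf ki) mulmx0.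
split=> // i j.
have V21 k l : (V2 k)^H *m V1 l = 0.
  by rewrite -[V1 l]adjmxK -adjmxM V12 adjmx0.
pose z := 1%:M - \sum_l V1 l *m (V1 l)^H - \sum_k V2 k *m (V2 k)^H.
have V1z l : (V1 l)^H *m z = 0.
  rewrite !mulmxBr mulmx1 !mulmx_sumr (bigD1 l) //= mulmxA VV1 eqxx mul1mx.
  rewrite !big1 ?addr0 ?subr0 ?subrr // => [k _|k kl].
    by rewrite mulmxA V12 mul0mx.
  by rewrite mulmxA VV1 eq_sym (negPf kl) raddf0 mul0mx.
have V2z k : (V2 k)^H *m z = 0.
  rewrite !mulmxBr mulmx1 !mulmx_sumr [X in _ - X](bigD1 k) //= mulmxA VV2 eqxx mul1mx.
  rewrite !big1 ?addr0 ?subr0 ?subrr // => [l lk|l _].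
    by rewrite mulmxA VV2 eq_sym (negPf lk) raddf0 mul0mx.
  by rewrite mulmxA V21 mul0mx.
have Tz : T i j *m z = 0.
  have [l lj E1] := K1 _ z V1z i j; have [k ki E2] := K2 _ z V2z j i.
  have ik : i != k by rewrite eq_sym.
  have TTT : T i j *m ((T i j)^H *m (T i j *m z)) = 0.
    have := congr1 (mulmx^~ (T i j *m z)) (Tadj_diag dT i k j l).
    rewrite !mulmxDl -!mulmxA (mulmxA (T k l)^H) (disjoint0 dT ki lj) mul0mx.
    rewrite (mulmxA (T i l)^H) E1 (mulmxA (T k j)^H).
    rewrite -[(T k j)^H *m T i j *m z]/((swapf T j k)^H *m swapf T j i *m z) E2.
    by rewrite !mulmx0 !addr0.
  have TTz : (T i j)^H *m (T i j *m z) = 0.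
    by apply: adj_mulmx_eq0; rewrite adjmxM adjmxK -mulmxA TTT mulmx0.
  by apply: adj_mulmx_eq0; rewrite adjmxM -mulmxA TTz mulmx0.
move/eqP: Tz; rewrite !mulmxBr mulmx1 -addrA -opprD subr_eq0 => /eqP ->.
rewrite !mulmx_sumr (bigD1 j) //= [X in _ + X = _](bigD1 i) //=.
rewrite !mulmxA TV1 eqxx [T i j *m V2 i]TV2 eqxx.
rewrite !big1 ?addr0 // => [k ki|l lj].
  by rewrite mulmxA [_ *m V2 k]TV2 eq_sym (negPf ki) mul0mx.
by rewrite mulmxA TV1 eq_sym (negPf lj) mul0mx.
Qed.

End DisjointFamilies.

(** * Tensor products and block matrices *)

Section Tensor.
Variable C : numClosedFieldType.

Lemma adjmx_tens m n p q (A : 'M[C]_(m, n)) (B : 'M[C]_(p, q)) :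
  (tensmx A B)^H = tensmx A^H B^H.
Proof. by rewrite /adjmx trmx_tens map_mxT. Qed.

Lemma tensmx11 m n : tensmx (1%:M : 'M[C]_m) (1%:M : 'M[C]_n) = 1%:M.
Proof.
apply/matrixP=> a b; case: (mxtens_indexP a) => i j.
case: (mxtens_indexP b) => k l; rewrite tensmxE !mxE.
by rewrite (can_eq (@mxtens_indexK _ _)) xpair_eqE -natrM mulnb.
Qed.

Lemma unitary_tens m n p q (A : 'M[C]_(m, n)) (B : 'M[C]_(p, q)) :
  A \is unitarymx -> B \is unitarymx -> tensmx A B \is unitarymx.
Proof.
move=> /unitaryP AA /unitaryP BB; apply/unitaryP.
by rewrite adjmx_tens tensmx_mul AA BB tensmx11.
Qed.

Lemma mxtrace_tens m n (A : 'M[C]_m) (B : 'M[C]_n) :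
  \tr (tensmx A B) = \tr A * \tr B.
Proof. by rewrite /mxtrace mulr_sum; apply: eq_bigr => a _; rewrite mxE. Qed.

Lemma is_diag_tens m n (A : 'M[C]_m) (B : 'M[C]_n) :
  is_diag_mx A -> is_diag_mx B -> is_diag_mx (tensmx A B).
Proof.
move=> /is_diag_mxP A0 /is_diag_mxP B0; apply/is_diag_mxP=> a b.
case: (mxtens_indexP a) => i j; case: (mxtens_indexP b) => k l.
have [<-|ik] := eqVneq i k; last by rewrite tensmxE A0 ?mul0r.
have [<-|jl] := eqVneq j l; first by rewrite eqxx.
by rewrite tensmxE B0 ?mulr0.
Qed.

(** Row (i, a) is row a of W i, the pairs being enumerated as in [tensmx]. *)
Definition stackmx m q r (W : 'I_m -> 'M[C]_(q, r)) : 'M[C]_(m * q, r) :=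
  \matrix_(a, b) W (mxtens_unindex a).1 (mxtens_unindex a).2 b.

Lemma mul_stackmx m n q q' r s (W : 'I_m -> 'M[C]_(q, r))
    (W' : 'I_n -> 'M[C]_(q', s)) (A : 'M[C]_(m, n)) (D : 'M[C]_(q, q')) :
  (stackmx W)^H *m tensmx A D *m stackmx W' =
  \sum_i \sum_j A i j *: ((W i)^H *m D *m W' j).
Proof.
have sum2 a b (F : 'I_(a * b) -> C) :
    \sum_c F c = \sum_i \sum_j F (mxtens_index (i, j)).
  rewrite pair_big /= (reindex (@mxtens_index a b)) /=; last first.
    by exists (@mxtens_unindex a b) => c _; rewrite ?mxtens_indexK ?mxtens_unindexK.
  by apply: eq_bigr => -[].
apply/matrixP=> x y; rewrite summxE mxE sum2.
under [RHS]eq_bigr do rewrite summxE; rewrite [RHS]exchange_big /=.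
apply: eq_bigr => j _.
under eq_bigr do rewrite mxE sum2 [stackmx _ _ _]mxE mxtens_indexK mulr_suml.
rewrite exchange_big /=; apply: eq_bigr => i _.
rewrite mxE mxE mulr_sumr; apply: eq_bigr => b _.
rewrite mxE mulr_suml mulr_suml mulr_sumr; apply: eq_bigr => a _.
by rewrite tensmxE !adjmxE [stackmx _ _ _]mxE mxtens_indexK /=; ring.
Qed.

Lemma unitary_stackmx m q r (W : 'I_m -> 'M[C]_(q, r)) :
  (forall i k, W i *m (W k)^H = (i == k)%:R%:M) -> stackmx W \is unitarymx.
Proof.
move=> WW; apply/unitaryP/matrixP=> a b.
case: (mxtens_indexP a) => i j; case: (mxtens_indexP b) => k l.
have := congr1 (fun M : 'M_q => M j l) (WW i k); rewrite !mxE.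
rewrite (can_eq (@mxtens_indexK _ _)) xpair_eqE => E.
transitivity ((i == k)%:R *+ (j == l) : C).
  by rewrite -E; apply: eq_bigr => c _; rewrite !adjmxE !mxE !mxtens_indexK.
by rewrite -mulrnA mulnb.
Qed.

Lemma stack_orth m n q q' r (W : 'I_m -> 'M[C]_(q, r))
    (W' : 'I_n -> 'M[C]_(q', r)) :
  (forall i k, W i *m (W' k)^H = 0) -> stackmx W *m (stackmx W')^H = 0.
Proof.
move=> WW; apply/matrixP=> a b.
case: (mxtens_indexP a) => i j; case: (mxtens_indexP b) => k l.
have := congr1 (fun M : 'M_(q, q') => M j l) (WW i k); rewrite !mxE => E.
rewrite -[RHS]E; apply: eq_bigr => c _.
by rewrite !adjmxE !mxE !mxtens_indexK.
Qed.

Lemma block_sandwich p1 p2 q1 q2 r s (P1 : 'M[C]_(p1, r)) (P2 : 'M[C]_(p2, r))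
    (Q1 : 'M[C]_(q1, s)) (Q2 : 'M[C]_(q2, s)) (M : 'M[C]_(p1, q1))
    (N : 'M[C]_(p2, q2)) :
  (col_mx P1 P2)^H *m block_mx M 0 0 N *m col_mx Q1 Q2 =
  P1^H *m M *m Q1 + P2^H *m N *m Q2.
Proof.
by rewrite adj_col_mx mul_row_block !mulmx0 addr0 add0r mul_row_col.
Qed.

Lemma castmx_unitary p r (e : p = r) (P : 'M[C]_(p, r)) :
  P \is unitarymx -> castmx (e, erefl r) P \is unitarymx.
Proof. by case: r / e P => P; rewrite castmx_id. Qed.

(** The equations between sizes are absorbed into the outer factors. *)
Lemma cast_sandwich p q r s (er : p = r) (es : q = s) (P : 'M[C]_(p, r))
    (Q : 'M[C]_(q, s)) (M : 'M[C]_(p, q)) :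
  (castmx (er, erefl r) P)^H *m castmx (er, es) M *m castmx (es, erefl s) Q =
  P^H *m M *m Q.
Proof. by case: r / er P; case: s / es Q => Q P; rewrite !castmx_id. Qed.

Lemma unitary_uncast p r (e : p = r) (U : 'M[C]_r) : U \is unitarymx ->
  exists2 P : 'M[C]_(p, r), P \is unitarymx & U = castmx (e, erefl r) P.
Proof. by case: r / e U => U Uu; exists U; rewrite ?castmx_id. Qed.

End Tensor.

(** * From norm preservation to the block form *)

Section Necessity.
Variables (C : numClosedFieldType) (m n r s k' k : nat).
Variable Phi : {linear 'M[C]_(m, n) -> 'M[C]_(r, s)}.
Variables (F : 'M[C]_(r, s) -> C) (F' : 'M[C]_(m, n) -> C).
Hypotheses (tF : top_trace k F) (tF' : top_trace k' F').
Hypotheses (hk' : (2 <= k' <= minn m n)%N) (hk : (k <= minn r s)%N).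
Hypothesis HF : forall A, (\rank A <= 2)%N -> F (Phi A) = F' A.

(** For a pair that is optimal for X + mu Y, the values at X and at mu Y are at
most 1 and have sum 2. *)
Lemma maximizes_of_phases (X Y : 'M[C]_(r, s)) :
  F X = 1 ->
  (forall mu, `|mu| = 1 -> F (mu *: Y) = 1) ->
  (forall mu, `|mu| = 1 -> F (X + mu *: Y) = 2) ->
  forall mu, `|mu| = 1 -> exists (P : 'M[C]_(k, r)) (Q : 'M[C]_(k, s)),
     [/\ maximizes P Q X, maximizes P Q (mu *: Y),
         \tr (P *m X *m Q^H) != 0 & \tr (P *m Y *m Q^H) != 0].
Proof.
move=> FX FY FXY mu mu1.
have [P [Q [Pu Qu E]]] := tF.2 (X + mu *: Y).
have leX (P' : 'M_(k, r)) (Q' : 'M_(k, s)) : P' \is unitarymx -> Q' \is unitarymx ->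
    'Re (\tr (P' *m X *m Q'^H)) <= 1.
  by move=> Pu' Qu'; rewrite -FX; exact: tF.1.
have leY (P' : 'M_(k, r)) (Q' : 'M_(k, s)) : P' \is unitarymx -> Q' \is unitarymx ->
    'Re (\tr (P' *m (mu *: Y) *m Q'^H)) <= 1.
  by move=> Pu' Qu'; rewrite -(FY _ mu1); exact: tF.1.
have E2 : 'Re (\tr (P *m X *m Q^H)) + 'Re (\tr (P *m (mu *: Y) *m Q^H)) = 2.
  have := congr1 (fun z : C => 'Re z) E.
  rewrite mulmxDr mulmxDl !raddfD /= => ->; rewrite FXY //.
  by rewrite (Creal_ReP _ _) // realn.
have RX : 'Re (\tr (P *m X *m Q^H)) = 1.
  apply/eqP; rewrite eq_le leX //=.
  by rewrite -(lerD2r ('Re (\tr (P *m (mu *: Y) *m Q^H)))) E2 lerD2l leY.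
have RY : 'Re (\tr (P *m (mu *: Y) *m Q^H)) = 1.
  by apply: (addrI 1); rewrite -{1}RX E2.
exists P, Q; split.
- by split; [exact: Pu|exact: Qu|move=> P' Q' Pu' Qu'; rewrite RX; exact: leX].
- by split; [exact: Pu|exact: Qu|move=> P' Q' Pu' Qu'; rewrite RY; exact: leY].
- by apply/eqP => tr0; move/eqP: RX; rewrite tr0 raddf0 eq_sym oner_eq0.
- apply/eqP => tr0; move/eqP: RY; rewrite -scalemxAr -scalemxAl linearZ /= tr0.
  by rewrite mulr0 raddf0 eq_sym oner_eq0.
Qed.

(** x1^H y1 + mu x2^H y2 is a singular value decomposition with two singular
values 1, so all values of F involved are known. *)
Lemma orth_image_unit (x1 x2 : 'rV[C]_m) (y1 y2 : 'rV[C]_n) :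
  x1 \is unitarymx -> x2 \is unitarymx -> y1 \is unitarymx -> y2 \is unitarymx ->
  x1 *m x2^H = 0 -> y1 *m y2^H = 0 ->
  orth (Phi (x1^H *m y1)) (Phi (x2^H *m y2)) /\
  exists2 mu, `|mu| = 1 &
    (\rank (Phi (x1^H *m y1) + mu *: Phi (x2^H *m y2))%R <= k)%N.
Proof.
case/andP: (hk') => k2 kmn.
have one (x : 'rV_m) (y : 'rV_n) : x \is unitarymx -> y \is unitarymx ->
    F (Phi (x^H *m y)) = 1.
  move=> xu yu; rewrite HF; last first.
    by rewrite (leq_trans (mxrankM_maxr _ _)) // (leq_trans (rank_leq_row _)).
  rewrite -[x^H]mulmx1 (top_trace_sum tF') ?scalar_mx_is_diag //.
  - by rewrite mxtrace1.
  - by rewrite kmn (leq_trans _ k2).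
  - by move=> a; rewrite mxE eqxx ler01.
have unitZ (y : 'rV[C]_n) mu : `|mu| = 1 -> y \is unitarymx ->
    mu *: y \is unitarymx.
  move=> mu1 /unitaryP yy; apply/unitaryP.
  by rewrite adjmxZ -scalemxAl -scalemxAr yy scalerA -normCK mu1 expr1n scale1r.
move=> x1u x2u y1u y2u x12 y12.
have main : forall mu : C, `|mu| = 1 ->
    F (Phi (x1^H *m y1) + mu *: Phi (x2^H *m y2)) = 2.
  move=> mu mu1.
  have y12u : col_mx y1 (mu *: y2) \is unitarymx.
    by rewrite unitary_col_mx ?unitZ // adjmxZ -scalemxAr y12 scaler0.
  have x12u : col_mx x1 x2 \is unitarymx by rewrite unitary_col_mx.
  have E : x1^H *m y1 + mu *: (x2^H *m y2) =
           (col_mx x1 x2)^H *m col_mx y1 (mu *: y2).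
    by rewrite adj_col_mx mul_row_col scalemxAr.
  rewrite -linearZ -linearD HF E; last first.
    by rewrite (leq_trans (mxrankM_maxr _ _)) // (leq_trans (rank_leq_row _)).
  rewrite -[_^H]mulmx1 (top_trace_sum tF') ?scalar_mx_is_diag //.
  - by rewrite mxtrace1.
  - by move=> a; rewrite mxE eqxx ler01.
have [||o1 o2 rk] := orth_of_phases (maximizes_of_phases _ _ main).
- exact: one.
- by move=> mu mu1; rewrite -linearZ /= scalemxAr one // unitZ.
- by split; [split|].
Qed.

Lemma orth_image (x1 x2 : 'rV[C]_m) (y1 y2 : 'rV[C]_n) :
  x1 != 0 -> x2 != 0 -> y1 != 0 -> y2 != 0 ->
  x1 *m x2^H = 0 -> y1 *m y2^H = 0 ->
  orth (Phi (x1^H *m y1)) (Phi (x2^H *m y2)).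
Proof.
move=> /unit_row[a1 a10 x1u] /unit_row[a2 a20 x2u].
move=> /unit_row[b1 b10 y1u] /unit_row[b2 b20 y2u] x12 y12.
have phiZ (a b : C) (x : 'rV_m) (y : 'rV_n) :
    Phi ((a *: x)^H *m (b *: y)) = (a^*%R * b) *: Phi (x^H *m y).
  by rewrite adjmxZ -scalemxAl -scalemxAr scalerA linearZ.
have [||[o1 o2] _] := orth_image_unit x1u x2u y1u y2u.
- by rewrite adjmxZ -scalemxAl -scalemxAr x12 !scaler0.
- by rewrite adjmxZ -scalemxAl -scalemxAr y12 !scaler0.
have z1 : a1^*%R * b1 != 0 by rewrite mulf_neq0 ?conjC_eq0 ?gt_eqF.
have z2 : a2^*%R * b2 != 0 by rewrite mulf_neq0 ?conjC_eq0 ?gt_eqF.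
move: o1 o2; rewrite !phiZ !adjmxZ -!scalemxAl -!scalemxAr !scalerA.
move/eqP; rewrite scaler_eq0 mulf_eq0 conjC_eq0 (negPf z1) (negPf z2) => /eqP o1.
move/eqP; rewrite scaler_eq0 mulf_eq0 conjC_eq0 (negPf z1) (negPf z2) => /eqP o2.
by split.
Qed.

Lemma delta_rowM p (i j : 'I_p) :
  (delta_mx 0 i : 'rV[C]_p) *m (delta_mx 0 j : 'rV[C]_p)^H = (i == j)%:R%:M.
Proof.
apply/matrixP=> a b; rewrite !ord1 -[X in X *m _]mulmx1 qform_delta !mxE.
by rewrite eqxx mulr1n.
Qed.

Lemma delta_row_unitary p (i : 'I_p) : (delta_mx 0 i : 'rV[C]_p) \is unitarymx.
Proof. by apply/unitaryP; rewrite delta_rowM eqxx. Qed.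

Lemma delta_row_orth p (i j : 'I_p) : i != j ->
  (delta_mx 0 i : 'rV[C]_p) *m (delta_mx 0 j : 'rV[C]_p)^H = 0.
Proof. by move=> ij; rewrite delta_rowM (negPf ij) raddf0. Qed.

Lemma delta_mxE (i : 'I_m) (j : 'I_n) :
  delta_mx i j = (delta_mx 0 i : 'rV[C]_m)^H *m (delta_mx 0 j : 'rV[C]_n).
Proof.
have -> : (delta_mx 0 i : 'rV[C]_m)^H = delta_mx i 0.
  by apply/matrixP=> a b; rewrite adjmxE !mxE conjC_nat andbC.
by rewrite mul_delta_mx.
Qed.

Lemma disjoint_image : disjoint_family (fun i j => Phi (delta_mx i j)).
Proof.
pose d p (a : 'I_p) : 'rV[C]_p := delta_mx 0 a.
have d1 p (a : 'I_p) : d p a != 0.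
  by apply/eqP => /rowP/(_ a)/eqP; rewrite !mxE !eqxx oner_eq0.
have dD p (a b : 'I_p) : a != b -> d p a + d p b != 0.
  move=> ab; apply/eqP => /rowP/(_ a)/eqP.
  by rewrite !mxE !eqxx (negPf ab) addr0 oner_eq0.
have dB p (a b : 'I_p) : a != b -> d p a - d p b != 0.
  move=> ab; apply/eqP => /rowP/(_ a)/eqP.
  by rewrite !mxE !eqxx (negPf ab) subr0 oner_eq0.
have dd p (a b : 'I_p) : a != b -> d p a *m (d p b)^H = 0.
  exact: delta_row_orth.
have ddDB p (a b : 'I_p) : a != b ->
    (d p a + d p b) *m (d p a - d p b)^H = 0.
  move=> ab; have ba : b != a by rewrite eq_sym.
  rewrite adjmxB !(mulmxDl, mulmxBr) !delta_rowM (negPf ab) (negPf ba) !eqxx.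
  by rewrite raddf0 subr0 sub0r subrr.
have PhiD A B : Phi (A + B) = Phi A + Phi B by exact: linearD.
have PhiN A : Phi (- A) = - Phi A by exact: linearN.
have E i j : delta_mx i j = (d m i)^H *m d n j by exact: delta_mxE.
move=> i i' j j' ii jj; split; rewrite !E.
- by apply: orth_image; [exact: d1|exact: d1|exact: d1|exact: d1|exact: dd|exact: dd].
- have := orth_image (dD _ _ _ ii) (dB _ _ _ ii) (d1 _ j) (d1 _ j')
    (ddDB _ _ _ ii) (dd _ _ _ jj).
  by rewrite adjmxD adjmxB mulmxDl mulmxBl !PhiD PhiN.
- have := orth_image (d1 _ i) (d1 _ i') (dD _ _ _ jj) (dB _ _ _ jj)
    (dd _ _ _ ii) (ddDB _ _ _ jj).
  by rewrite mulmxDr mulmxBr !PhiD PhiN.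
- have := orth_image (dD _ _ _ ii) (dB _ _ _ ii) (dD _ _ _ jj) (dB _ _ _ jj)
    (ddDB _ _ _ ii) (ddDB _ _ _ jj).
  rewrite adjmxD adjmxB mulmxDl mulmxBl !mulmxDr !mulmxN.
  by rewrite !(PhiD, PhiN) opprD opprK !addrA.
Qed.

(** The bound on q1 + q2 holds because Phi (E_00 + mu E_11) has rank
2 (q1 + q2), the frames at the indices (0, 0) and (1, 1) being orthogonal. *)
Lemma necessity :
  exists (q1 q2 : nat) (e1 : 'rV[C]_q1) (e2 : 'rV[C]_q2)
      (P : 'M[C]_(m * q1 + n * q2, r)) (Q : 'M[C]_(n * q1 + m * q2, s)),
    [/\ P \is unitarymx /\ Q \is unitarymx,
        (forall a, 0 < e1 0 a) /\ (forall a, 0 < e2 0 a),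
        (2 * (q1 + q2) <= k)%N,
        \tr (diag_mx e1) + \tr (diag_mx e2) = 1 &
        forall A, Phi A =
          P^H *m block_mx (tensmx A (diag_mx e1)) 0 0 (tensmx A^T (diag_mx e2))
            *m Q].
Proof.
have [m2 n2] : (1 < m)%N /\ (1 < n)%N.
  by case/andP: hk' => k2; rewrite leq_min => /andP[km kn]; rewrite !(leq_trans k2).
pose i0 := Ordinal (ltnW m2); pose i1 := Ordinal m2.
pose j0 := Ordinal (ltnW n2); pose j1 := Ordinal n2.
have i01 : i0 != i1 by []. have j01 : j0 != j1 by [].
have [q1 [q2 [e1 [e2 [U1 [V1 [U2 [V2
  [[e10 e20] [UU1 VV1] [UU2 VV2] [U12 V12] TE]]]]]]]]] :=
  frame_decomposition disjoint_image i01 j01.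
have U21 i j : (U2 j)^H *m U1 i = 0.
  by rewrite -[U1 i]adjmxK -adjmxM U12 adjmx0.
have V21 i j : (V2 i)^H *m V1 j = 0.
  by rewrite -[V1 j]adjmxK -adjmxM V12 adjmx0.
pose W1 i := (U1 i)^H; pose W2 j := (U2 j)^H.
pose X1 j := (V1 j)^H; pose X2 i := (V2 i)^H.
have W1u : stackmx W1 \is unitarymx.
  by apply: unitary_stackmx => i k0; rewrite /W1 adjmxK UU1.
have W2u : stackmx W2 \is unitarymx.
  by apply: unitary_stackmx => i k0; rewrite /W2 adjmxK UU2.
have X1u : stackmx X1 \is unitarymx.
  by apply: unitary_stackmx => i k0; rewrite /X1 adjmxK VV1.
have X2u : stackmx X2 \is unitarymx.
  by apply: unitary_stackmx => i k0; rewrite /X2 adjmxK VV2.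
pose P i j := col_mx (U1 i)^H (U2 j)^H.
pose Q i j := col_mx (V1 j)^H (V2 i)^H.
have TP i j : Phi (delta_mx i j) = (P i j)^H *m diag_mx (row_mx e1 e2) *m Q i j.
  by rewrite diag_mx_row block_sandwich !adjmxK TE.
have dotP i j i' j' : P i j *m (P i' j')^H =
    block_mx (i == i')%:R%:M 0 0 (j == j')%:R%:M.
  by rewrite adj_col_mx mul_col_row !adjmxK UU1 UU2 U12 U21.
have dotQ i j i' j' : Q i j *m (Q i' j')^H =
    block_mx (j == j')%:R%:M 0 0 (i == i')%:R%:M.
  by rewrite adj_col_mx mul_col_row !adjmxK VV1 VV2 V12 V21.
have Pu i j : P i j \is unitarymx.
  by apply/unitaryP; rewrite dotP !eqxx -scalar_mx_block.
have Qu i j : Q i j \is unitarymx.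
  by apply/unitaryP; rewrite dotQ !eqxx -scalar_mx_block.
have De_unit : diag_mx (row_mx e1 e2) \in unitmx.
  apply: diag_pos_unit => a; case: (split_ordP a) => b ->.
    by rewrite row_mxEl.
  by rewrite row_mxEr.
have qk : (2 * (q1 + q2) <= k)%N.
  have [_ [mu mu1]] := orth_image_unit (delta_row_unitary i0)
    (delta_row_unitary i1) (delta_row_unitary j0) (delta_row_unitary j1)
    (delta_row_orth i01) (delta_row_orth j01).
  rewrite -!delta_mxE; apply: leq_trans; rewrite !TP.
  set De := diag_mx _ in De_unit *.
  have PP : P i0 j0 *m (P i1 j1)^H = 0.
    by rewrite dotP (negPf i01) (negPf j01) !raddf0 block_mx0.
  have QQ : Q i0 j0 *m (Q i1 j1)^H = 0.
    by rewrite dotQ (negPf i01) (negPf j01) !raddf0 block_mx0.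
  have PPu := unitary_col_mx (Pu _ _) (Pu _ _) PP.
  have QQu := unitary_col_mx (Qu _ _) (Qu _ _) QQ.
  set X := (X in \rank X).
  have XE : X = (col_mx (P i0 j0) (P i1 j1))^H *m block_mx De 0 0 (mu *: De) *m
                col_mx (Q i0 j0) (Q i1 j1).
    by rewrite block_sandwich -scalemxAr -scalemxAl.
  have mid : col_mx (P i0 j0) (P i1 j1) *m X *m (col_mx (Q i0 j0) (Q i1 j1))^H =
             block_mx De 0 0 (mu *: De).
    rewrite XE !mulmxA (unitaryP PPu) mul1mx -mulmxA (unitaryP QQu) mulmx1 //.
  have mu0 : mu != 0 by rewrite -normr_eq0 mu1 oner_eq0.
  have Bu : block_mx De 0 0 (mu *: De) \in unitmx.
    by rewrite unitmxE det_ublock unitrM -!unitmxE unitmxZ ?unitfE // De_unit.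
  rewrite mul2n -addnn -(mxrank_unit Bu) -mid.
  by apply: leq_trans (mxrankM_maxl _ _) (mxrankM_maxr _ _).
exists q1, q2, e1, e2, (col_mx (stackmx W1) (stackmx W2)),
  (col_mx (stackmx X1) (stackmx X2)).
split=> //.
- split; apply: unitary_col_mx => //; apply: stack_orth => i j.
    by rewrite /W1 /W2 adjmxK U12.
  by rewrite /X1 /X2 adjmxK V12.
- have kq : (q1 + q2 <= k <= minn r s)%N.
    by rewrite hk andbT (leq_trans _ qk) // leq_pmull.
  have := top_trace_sum tF kq (Pu i0 j0) (Qu i0 j0)
    (diag_mx_is_diag (row_mx e1 e2)).
  rewrite -TP diag_mx_row mxtrace_block => <-; last first.
    move=> a; case: (split_ordP a) => b ->.
      by rewrite block_mxEul mxE eqxx mulr1n ltW.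
    by rewrite block_mxEdr mxE eqxx mulr1n ltW.
  have krk : (1 <= k' <= minn m n)%N.
    by case/andP: hk' => k2 ->; rewrite (leq_trans _ k2).
  rewrite HF; last first.
    by rewrite delta_mxE (leq_trans (mxrankM_maxr _ _)) // (leq_trans (rank_leq_row _)).
  rewrite delta_mxE -[(delta_mx 0 i0)^H]mulmx1.
  rewrite (top_trace_sum tF' krk) ?delta_row_unitary ?scalar_mx_is_diag ?mxtrace1 //.
  by move=> a; rewrite mxE eqxx ler01.
- move=> A; rewrite block_sandwich !mul_stackmx [X in _ + X]exchange_big /=.
  rewrite {1}[A]matrix_sum_delta linear_sum -big_split /=.
  apply: eq_bigr => i _; rewrite linear_sum -big_split /=.
  apply: eq_bigr => j _; rewrite linearZ /= TE scalerDr mxE.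
  by rewrite /W1 /W2 /X1 /X2 !adjmxK.
Qed.

End Necessity.

(** * From the block form to norm preservation *)

Section Sufficiency.
Variable C : numClosedFieldType.

Lemma compact_svd m n (A : 'M[C]_(m, n)) :
  exists (U : 'M[C]_(\rank A, m)) (V : 'M[C]_(\rank A, n)) (e : 'rV[C]_(\rank A)),
    [/\ U \is unitarymx, V \is unitarymx, forall a, 0 < e 0 a &
        A = U^H *m diag_mx e *m V].
Proof.
suff [p [U [V [e [Uu Vu e0 AE]]]]] : exists p (U : 'M[C]_(p, m))
    (V : 'M[C]_(p, n)) (e : 'rV[C]_p), [/\ U \is unitarymx, V \is unitarymx,
    forall a, 0 < e 0 a & A = U^H *m diag_mx e *m V].
  have -> : \rank A = p; last by exists U, V, e.
  apply/eqP; rewrite eqn_leq {1}AE -mulmxA.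
  rewrite (leq_trans (mxrankM_maxr _ _)) ?(leq_trans (rank_leq_row _)) //=.
  rewrite -[leqLHS](mxrank_unit (diag_pos_unit e0)).
  have -> : diag_mx e = U *m A *m V^H.
    by rewrite AE !mulmxA (unitaryP Uu) mul1mx -mulmxA (unitaryP Vu) mulmx1.
  by rewrite (leq_trans (mxrankM_maxl _ _)) // mxrankM_maxr.
have [p [V [d [Vu d0 NE]]]] := psd_compact (psd_gram A).
pose e := map_mx sqrtC d; have e0 a : 0 < e 0 a by rewrite mxE sqrtC_gt0.
pose D := diag_mx e; pose E := invmx D.
have DE : D *m E = 1%:M by rewrite mulmxV // diag_pos_unit.
have ED : E *m D = 1%:M by rewrite mulVmx // diag_pos_unit.
have DD : D *m D = diag_mx d by exact: sqrt_diagK.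
have DH : D^H = D by exact: adj_diag_pos.
have EH : E^H = E by rewrite adj_invmx DH.
exists p, (E *m V *m A^H), V, e; split=> //.
  apply/unitaryP; rewrite !adjmxM !adjmxK EH !mulmxA -(mulmxA _ A^H) NE.
  rewrite !mulmxA -(mulmxA E V) (unitaryP Vu) mulmx1 -(mulmxA _ V) (unitaryP Vu).
  by rewrite mulmx1 -DD mulmxA ED mul1mx DE.
rewrite !adjmxM adjmxK EH !mulmxA -(mulmxA _ E) ED mulmx1.
apply/eqP; rewrite -subr_eq0; apply/eqP/adj_mulmx_eq0.
have -> : A - A *m V^H *m V = A *m (1%:M - V^H *m V).
  by rewrite mulmxBr mulmx1 mulmxA.
rewrite adjmxM -mulmxA (mulmxA A^H) NE mulmxBr mulmx1 mulmxA.
by rewrite -(mulmxA _ V) (unitaryP Vu) mulmx1 subrr mulmx0.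
Qed.

Lemma adj_block_diag a b c d (X : 'M[C]_(a, b)) (Y : 'M[C]_(c, d)) :
  (block_mx X 0 0 Y)^H = block_mx X^H 0 0 Y^H.
Proof. by rewrite /adjmx tr_block_mx map_block_mx !trmx0 !map_mx0. Qed.

Lemma mul_block_diag a b c d e f (X : 'M[C]_(a, b)) (Y : 'M[C]_(c, d))
    (X' : 'M[C]_(b, e)) (Y' : 'M[C]_(d, f)) :
  block_mx X 0 0 Y *m block_mx X' 0 0 Y' = block_mx (X *m X') 0 0 (Y *m Y').
Proof. by rewrite mulmx_block !mulmx0 !mul0mx !addr0 add0r. Qed.

Lemma unitary_block_diag a b c d (X : 'M[C]_(a, b)) (Y : 'M[C]_(c, d)) :
  X \is unitarymx -> Y \is unitarymx -> block_mx X 0 0 Y \is unitarymx.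
Proof.
move=> /unitaryP XX /unitaryP YY; apply/unitaryP.
by rewrite adj_block_diag mul_block_diag XX YY -scalar_mx_block.
Qed.

(** The factors of a singular value decomposition of A, tensored with identity
matrices, are those of one of Phi A with p (q1 + q2) <= k terms, where
p <= 2 is the rank of A. *)
Lemma sufficiency m n r s k' k (Phi : 'M[C]_(m, n) -> 'M[C]_(r, s)) F F'
    (q1 q2 : nat) (D1 : 'M[C]_q1) (D2 : 'M[C]_q2)
    (P : 'M[C]_(m * q1 + n * q2, r)) (Q : 'M[C]_(n * q1 + m * q2, s)) :
  @top_trace C k r s F -> @top_trace C k' m n F' ->
  (2 <= k' <= minn m n)%N -> (k <= minn r s)%N -> (2 * (q1 + q2) <= k)%N ->
  P \is unitarymx -> Q \is unitarymx ->
  is_diag_mx D1 -> (forall a, 0 <= D1 a a) ->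
  is_diag_mx D2 -> (forall a, 0 <= D2 a a) -> \tr D1 + \tr D2 = 1 ->
  (forall A, Phi A = P^H *m block_mx (tensmx A D1) 0 0 (tensmx A^T D2) *m Q) ->
  forall A, (\rank A <= 2)%N -> F (Phi A) = F' A.
Proof.
move=> tF tF' /andP[k2 k'mn] krs qk Pu Qu D1d D10 D2d D20 tr1 PhiE A rA.
have [U [V [e [Uu Vu e0 AE]]]] := compact_svd A.
move: (\rank A) U V e rA Uu Vu e0 AE => p U V e p2 Uu Vu e0 AE.
have ed : is_diag_mx (diag_mx e) by exact: diag_mx_is_diag.
have e0' a : 0 <= diag_mx e a a by rewrite mxE eqxx mulr1n ltW.
rewrite AE (top_trace_sum tF') ?k'mn ?(leq_trans p2) // -AE.
pose U' := map_mx Num.conj U; pose V' := map_mx Num.conj V.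
have U'u : U' \is unitarymx by rewrite conjC_unitary.
have V'u : V' \is unitarymx by rewrite conjC_unitary.
(* Transposition exchanges the factors and conjugates them. *)
have ATE : A^T = V'^H *m diag_mx e *m U'.
  have -> : V'^H = V^T by apply/matrixP=> a b; rewrite adjmxE !mxE conjCK.
  have -> : U' = (U^H)^T by apply/matrixP=> a b; rewrite !mxE.
  by rewrite AE !trmx_mul tr_diag_mx !mulmxA.
have unit1 q : (1%:M : 'M[C]_q) \is unitarymx.
  by apply/unitaryP; rewrite adjmx1 mulmx1.
have tensE a b q (X : 'M[C]_(p, a)) (Y : 'M[C]_(p, b)) (D : 'M[C]_q) (Z : 'M_(a, b)) :
    Z = X^H *m diag_mx e *m Y -> tensmx Z D =
    (tensmx X (1%:M : 'M_q))^H *m tensmx (diag_mx e) D *m tensmx Y (1%:M : 'M_q).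
  by move=> ->; rewrite adjmx_tens !tensmx_mul adjmx1 mul1mx mulmx1.
pose L := block_mx (tensmx U (1%:M : 'M_q1)) 0 0 (tensmx V' (1%:M : 'M_q2)).
pose N := block_mx (tensmx V (1%:M : 'M_q1)) 0 0 (tensmx U' (1%:M : 'M_q2)).
pose M := block_mx (tensmx (diag_mx e) D1) 0 0 (tensmx (diag_mx e) D2).
have PhiAE : Phi A = (L *m P)^H *m M *m (N *m Q).
  rewrite PhiE (tensE _ _ _ _ _ D1 _ AE) (tensE _ _ _ _ _ D2 _ ATE).
  by rewrite -!mul_block_diag -adj_block_diag adjmxM !mulmxA.
have Lu : L \is unitarymx by rewrite unitary_block_diag ?unitary_tens.
have Nu : N \is unitarymx by rewrite unitary_block_diag ?unitary_tens.
have pq : (p * q1 + p * q2 <= k <= minn r s)%N.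
  by rewrite krs andbT -mulnDr (leq_trans _ qk) // leq_mul2r p2 orbT.
have tens0 q (D : 'M[C]_q) : (forall a, 0 <= D a a) ->
    forall a, 0 <= tensmx (diag_mx e) D a a.
  by move=> D0 a; case: (mxtens_indexP a) => i j; rewrite tensmxE mulr_ge0.
rewrite PhiAE (top_trace_sum tF pq) ?mul_unitarymx //.
- by rewrite mxtrace_block !mxtrace_tens -mulrDr tr1 mulr1.
- by rewrite is_diag_block_mx // eqxx !is_diag_tens //= !eqxx.
- move=> a; case: (split_ordP a) => b ->.
    by rewrite block_mxEul tens0.
  by rewrite block_mxEdr tens0.
Qed.

End Sufficiency.

(** * The characterization *)

Lemma diag_posdef (R : realType) q (e : 'rV[R[i]]_q) :
  (forall a, 0 < e 0 a) -> posdefmx (diag_mx e).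
Proof.
move=> e0; split.
  apply/is_hermitianmxP; rewrite expr0 scale1r.
  exact/esym/(adj_diag_pos e0).
move=> x x0; rewrite -[ctmx x]/(x^H) -mulmxA mxE.
have term a : x^H 0 a * (diag_mx e *m x) a 0 = e 0 a * (x a 0 * (x a 0)^*%R).
  by rewrite adjmxE mul_diag_mx mxE mulrCA [_^*%R * _]mulrC.
under eq_bigr do rewrite term.
have ge0 a : 0 <= e 0 a * (x a 0 * (x a 0)^*%R).
  by rewrite mulr_ge0 ?mul_conjC_ge0 // ltW.
have /matrix0Pn[a [b xab]] := x0; rewrite ord1 in xab.
rewrite (bigD1 a) //= ltr_pwDl ?sumr_ge0 //.
by rewrite mulr_gt0 ?mul_conjC_gt0.
Qed.

Lemma posdef_diag_ge0 (R : realType) q (Q : 'M[R[i]]_q) a :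
  posdefmx Q -> 0 <= Q a a.
Proof.
case=> _ Qpos; rewrite -qform_delta; set x : 'rV_q := delta_mx 0 a.
have x0 : x^H != 0.
  apply/eqP => /colP/(_ a)/eqP; rewrite adjmxE !mxE !eqxx conjC1.
  by rewrite oner_eq0.
by have := Qpos _ x0; rewrite -[ctmx _]/(x^H^H) adjmxK => /ltW.
Qed.

Theorem theorem4p2 (R : realType) (m n r s k' k : nat)
    (hm : (0 < m)%N) (hn : (0 < n)%N) (hr : (0 < r)%N) (hs : (0 < s)%N)
    (hk' : (2 <= k' <= minn m n)%N) (hk : (1 <= k <= minn r s)%N)
    (Phi : {linear 'M[R[i]]_(m, n) -> 'M[R[i]]_(r, s)}) :
  (forall A : 'M[R[i]]_(m, n), (\rank A <= 2)%N ->
     ky_fan k (Phi A) = ky_fan k' A)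
  <->
  (exists (U : 'M[R[i]]_r) (V : 'M[R[i]]_s) (q1 q2 : nat)
          (Q1 : 'M[R[i]]_q1) (Q2 : 'M[R[i]]_q2) (r0 s0 : nat)
          (er : (m * q1 + n * q2 + r0 = r)%N)
          (es : (n * q1 + m * q2 + s0 = s)%N),
     [/\ U \is unitarymx /\ V \is unitarymx,
         is_diag_mx Q1 /\ posdefmx Q1,
         is_diag_mx Q2 /\ posdefmx Q2,
         (2 * (q1 + q2) <= k)%N /\ \tr (block_mx Q1 0 0 Q2) = 1 &
         forall A : 'M[R[i]]_(m, n),
           Phi A =
           U *m castmx (er, es)
                  (block_mx (block_mx (tensmx A Q1) 0 0 (tensmx A^T Q2)) 0
                            0 0)
             *m V]).
Proof.
have [_ krs] := andP hk; have [_ k'mn] := andP hk'.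
have tF := ky_fan_variational R krs; have tF' := ky_fan_variational R k'mn.
split=> [HF|].
  have HFC A : (\rank A <= 2)%N -> (ky_fan k (Phi A))%:C = (ky_fan k' A)%:C.
    by move=> rA; rewrite HF.
  have [q1 [q2 [e1 [e2 [P [Q [[Pu Qu] [e10 e20] qk tr1 PhiE]]]]]]] :=
    necessity tF tF' hk' krs HFC.
  have rle p a (W : 'M[R[i]]_(p, a)) : W \is unitarymx -> (p <= a)%N.
    by move=> /mxrank_unitary <-; exact: rank_leq_col.
  have er := subnKC (rle _ _ _ Pu); have es := subnKC (rle _ _ _ Qu).
  set r0 := (r - _)%N in er; set s0 := (s - _)%N in es.
  have [P' P'u PP'] := @unitary_complete _ _ r0 _ _ Pu (eq_leq er).
  have [Q' Q'u QQ'] := @unitary_complete _ _ s0 _ _ Qu (eq_leq es).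
  have PPu := unitary_col_mx Pu P'u PP'.
  have QQu := unitary_col_mx Qu Q'u QQ'.
  exists (castmx (er, erefl r) (col_mx P P'))^H.
  exists (castmx (es, erefl s) (col_mx Q Q')).
  exists q1, q2, (diag_mx e1), (diag_mx e2), r0, s0, er, es; split.
  - split; last exact: castmx_unitary.
    by rewrite trmxC_unitary; exact: castmx_unitary.
  - by split; [exact: diag_mx_is_diag | exact: diag_posdef].
  - by split; [exact: diag_mx_is_diag | exact: diag_posdef].
  - by split=> //; rewrite mxtrace_block.
  - by move=> A; rewrite cast_sandwich block_sandwich mulmx0 mul0mx addr0.
move=> [U [V [q1 [q2 [D1 [D2 [r0 [s0 [er [es]]]]]]]]]].
case=> -[Uu Vu] [D1d D1p] [D2d D2p] [qk tr1] PhiE A rA.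
have UHu : U^H \is unitarymx by rewrite trmxC_unitary.
have [P Pu UE] := unitary_uncast er UHu.
have [Q Qu VE] := unitary_uncast es Vu.
apply: complexI.
have usub p1 p2 a (W : 'M[R[i]]_(p1 + p2, a)) :
    W \is unitarymx -> usubmx W \is unitarymx.
  move=> Wu; have -> : usubmx W = rowsub (lshift p2) W.
    by apply/matrixP=> x y; rewrite !mxE.
  by apply: unitary_rowsub => //; exact: lshift_inj.
apply: (sufficiency tF tF' hk' krs qk (usub _ _ _ _ Pu) (usub _ _ _ _ Qu)
  D1d _ D2d) => //.
- by move=> a; exact: posdef_diag_ge0.
- by move=> a; exact: posdef_diag_ge0.
- by rewrite -tr1 mxtrace_block.
move=> B; rewrite PhiE -[U]adjmxK UE VE cast_sandwich.
by rewrite -{1}[P]vsubmxK -{1}[Q]vsubmxK block_sandwich mulmx0 mul0mx addr0.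
Qed.
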